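(* Let $1\le M\le N$, let $W\in\mathbb{R}^{N\times N}$ be symmetric positive definite, let $B_0\in\mathbb{R}^{N\times N}$ be symmetric, and let $B$ be a random symmetric $N\times N$ matrix with Gaussian prior of mean $B_0$ and covariance $V=W\circledast W$ on its elements, i.e. $\mathrm{vec}(B)\sim\mathcal{N}(\mathrm{vec}(B_0),\,W\circledast W)$. Let $S\in\mathbb{R}^{N\times M}$ with $\operatorname{rank}(S)=M$. Then the posterior distribution of $B$ after the noise-free observations $Y=BS\in\mathbb{R}^{N\times M}$ is Gaussian with mean $$ \begin{aligned} B_M &= B_0 + (Y-B_0S)(S^{\top} W S)^{-1}S^{\top} W + WS(S^{\top} W S)^{-1}(Y-B_0S)^{\top}\\ &\quad - WS(S^{\top} W S)^{-1}\bigl(S^{\top}(Y-B_0S)\bigr)(S^{\top} W S)^{-1}S^{\top} W \end{aligned} $$ and covariance $$ V_M = \bigl(W - WS(S^{\top} W S)^{-1}S^{\top} W\bigr)\circledast \bigl(W - WS(S^{\top} W S)^{-1}S^{\top} W\bigr). $$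
   Context: For a matrix $A\in\mathbb{R}^{N\times N}$, $\mathrm{vec}(A)\in\mathbb{R}^{N^2}$ is the vector of its elements obtained by stacking the rows, indexed by pairs $(i,j)$: $\mathrm{vec}(A)_{(ij)}=A_{ij}$. For a symmetric matrix $A\in\mathbb{R}^{N\times N}$, the symmetric Kronecker product $A\circledast A$ of $A$ with itself is the $N^2\times N^2$ matrix with elements $$(A\circledast A)_{(ij),(k\ell)}=\tfrac12\,(A_{ik}A_{j\ell}+A_{jk}A_{i\ell}).$$ $\mathcal{N}(\mu,\Sigma)$ denotes the (possibly degenerate) Gaussian law with mean $\mu$ and positive semidefinite covariance $\Sigma$; in particular $\mathcal{N}(\mathrm{vec}(B_0),W\circledast W)$ with $B_0$ symmetric is supported on the symmetric matrices. The posterior after the noise-free observation $Y=BS$ is the conditional distribution of $\mathrm{vec}(B)$ given $BS=Y$, where $Y$ is a value attained by $\tilde B S$ for some symmetric $\tilde B$. (It is also the limit $\sigma\to0$ of the posteriors under the Gaussian likelihood with mean $BS$ and i.i.d. noise of variance $\sigma^2$ on the entries.) *)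

(* Defs.v *)
From HB Require Import structures.
From mathcomp Require Import all_boot all_order all_algebra.
From mathcomp Require Import all_classical all_reals all_analysis.

Set Implicit Arguments.
Unset Strict Implicit.
Unset Printing Implicit Defensive.

Import Order.TTheory GRing.Theory Num.Theory.
Import numFieldNormedType.Exports.

Local Open Scope classical_set_scope.
Local Open Scope ring_scope.

(** Matrices carry the product sigma-algebra, generated by the coordinates; over
    [R] this is the Borel sigma-algebra. *)

Definition mx_cylinder d (T : measurableType d) (m n : nat) :
    set (set 'M[T]_(m, n)) :=
  [set C | exists (i : 'I_m) (j : 'I_n) (A : set T),
     measurable A /\ C = [set X : 'M[T]_(m, n) | A (X i j)]].

Definition mx_display : measure_display -> measure_display.
Proof. exact. Qed.

Section measurable_matrix.
Context d (T : measurableType d) (m n : nat).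

Let mx_measurable0 : <<s @mx_cylinder d T m n >> set0.
Proof. exact: sigma_algebra0. Qed.

Let mx_measurableC A :
  <<s @mx_cylinder d T m n >> A -> <<s @mx_cylinder d T m n >> (~` A).
Proof. exact: sigma_algebraC. Qed.

Let mx_measurable_bigcup (F : (set 'M[T]_(m, n))^nat) :
  (forall i, <<s @mx_cylinder d T m n >> (F i)) ->
  <<s @mx_cylinder d T m n >> (\bigcup_i F i).
Proof. exact: sigma_algebra_bigcup. Qed.

HB.instance Definition _ := @isMeasurable.Build (mx_display d) 'M[T]_(m, n)
  <<s @mx_cylinder d T m n >> mx_measurable0 mx_measurableC
  mx_measurable_bigcup.

End measurable_matrix.

Lemma measurable_coord d (T : measurableType d) m n (i : 'I_m) (j : 'I_n) :
  measurable_fun [set: 'M[T]_(m, n)] (fun X => X i j).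
Proof.
move=> _ A mA; rewrite setTI; apply: sub_sigma_algebra.
by exists i, j, A.
Qed.

Lemma measurable_fun_mx d d' (U : measurableType d') (T : measurableType d) m n
    (f : U -> 'M[T]_(m, n)) :
  (forall i j, measurable_fun setT (fun u => f u i j)) -> measurable_fun setT f.
Proof.
move=> mf.
apply: (@measurability _ _ _ _ setT f (@mx_cylinder d T m n)) => //.
by move=> _ [_ [i [j [A [mA ->]]]] <-]; exact: mf.
Qed.

Lemma measurable_mxvec (R : realType) m n :
  measurable_fun setT (@mxvec R m n).
Proof.
apply: measurable_fun_mx => i k; rewrite ord1; case/mxvec_indexP: k => a b.
rewrite (_ : (fun u => _) = (fun u : 'M[R]_(m, n) => u a b)).
  exact: measurable_coord.
by apply/funext => u; rewrite mxvecE.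
Qed.

HB.instance Definition _ (R : realType) m n :=
  @isMeasurableFun.Build _ _ _ _ (@mxvec R m n) (@measurable_mxvec R m n).

Definition mxvec_pair (m n : nat) (k : 'I_(m * n)) : 'I_m * 'I_n :=
  enum_val (cast_ord (esym (mxvec_cast m n)) k).

Lemma mxvec_indexK m n (i : 'I_m) (j : 'I_n) :
  mxvec_pair (mxvec_index i j) = (i, j).
Proof. by rewrite /mxvec_pair /mxvec_index cast_ordK enum_rankK. Qed.

Definition symkron (R : realType) (N : nat) (A : 'M[R]_N) : 'M[R]_(N * N) :=
  \matrix_(p, q)
    let: (i, j) := mxvec_pair p in let: (k, l) := mxvec_pair q in
    2^-1 * (A i k * A j l + A j k * A i l).

Lemma symkronE (R : realType) N (A : 'M[R]_N) (i j k l : 'I_N) :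
  symkron A (mxvec_index i j) (mxvec_index k l) =
  2^-1 * (A i k * A j l + A j k * A i l).
Proof. by rewrite mxE !mxvec_indexK. Qed.

Definition sympd (R : realType) (n : nat) (A : 'M[R]_n) : Prop :=
  A^T = A /\ forall x : 'rV[R]_n, x != 0 -> 0 < (x *m A *m x^T) 0 0.

Definition sympsd (R : realType) (n : nat) (A : 'M[R]_n) : Prop :=
  A^T = A /\ forall x : 'rV[R]_n, 0 <= (x *m A *m x^T) 0 0.

(** [normal_prob] takes the standard deviation, and at standard deviation 0 it
    is the uniform law on [0, 1], whence the case distinction. *)
Definition gauss1 (R : realType) (m v : R) : set R -> \bar R :=
  if v == 0 then (\d_m : set R -> \bar R) else normal_prob m (Num.sqrt v).

(** [Q] is the (possibly degenerate) law N(mu, Sigma) on R^n: every linear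
    functional a has under [Q] the law N(a mu, a Sigma a^T) on R. *)
Definition gaussian (R : realType) (n : nat) (mu : 'rV[R]_n) (Sigma : 'M[R]_n)
    (Q : {measure set 'rV[R]_n -> \bar R}) : Prop :=
  sympsd Sigma /\
  forall (a : 'rV[R]_n) (A : set R), measurable A ->
    Q [set x : 'rV[R]_n | A ((x *m a^T) 0 0)] =
    gauss1 ((mu *m a^T) 0 0) ((a *m Sigma *m a^T) 0 0) A.

(** [k] is a (version of the) regular conditional distribution of [X] given
    [Z], i.e. P(X in A | Z) = k(Z, A) almost surely. *)
Definition cond_distribution d d1 d2 (Omega : measurableType d)
    (U : measurableType d1) (V : measurableType d2) (R : realType)
    (P : probability Omega R) (X : Omega -> U) (Z : Omega -> V)
    (k : R.-pker V ~> U) : Prop :=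
  forall (A : set U) (C : set V), measurable A -> measurable C ->
    P (X @^-1` A `&` Z @^-1` C) = (\int[P]_(w in Z @^-1` C) k (Z w) A)%E.

Section posterior.
Context (R : realType) (N M : nat).

Definition post_mean (W B0 : 'M[R]_N) (S Y : 'M[R]_(N, M)) : 'M[R]_N :=
  let G := invmx (S^T *m W *m S) in
  let D := Y - B0 *m S in
  B0 + D *m G *m S^T *m W + W *m S *m G *m D^T
     - W *m S *m G *m (S^T *m D) *m G *m S^T *m W.

Definition post_cov (W : 'M[R]_N) (S : 'M[R]_(N, M)) : 'M[R]_(N * N) :=
  symkron (W - W *m S *m invmx (S^T *m W *m S) *m S^T *m W).

End posterior.

(* Main.v *)
(** Put [Q = I - W S (S^T W S)^-1 S^T]. Algebraically, for symmetric [B],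
    [B = B_M(BS) + Q (B - B0) Q^T], where [B_M(Y)] is the stated mean, and
    [Q W Q^T = W - W S (S^T W S)^-1 S^T W] while [S^T W Q^T = 0]. So the residual
    [E = Q (B - B0) Q^T] is centred Gaussian with the stated covariance and is
    uncorrelated with [BS]. If [E] and [BS] are independent, the conditional law of [B]
    given [BS = Y] is the law of [B_M(Y) + E].

    Since a Gaussian is given through its linear functionals only, independence is
    obtained through trigonometric functions. The characteristic function [g(v)] of
    [N(0, v)] satisfies [g(v1 + v2) = g(v1) g(v2)], by the convolution formula for normal
    densities, so [cos (<a, E> + c)] and [cos (<b, BS> + e)] are uncorrelated. The
    cosines generate all indicators of measurable sets under linear combinations and
    bounded pointwise limits, and both operations preserve factorisation of expectations.

    Two versions of the conditional law agree almost surely on each of countably many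
    boxes with rational corners, hence almost surely as measures. *)

Require Import Defs.
From HB Require Import structures.
From mathcomp Require Import all_boot all_order all_algebra.
From mathcomp Require Import all_classical all_reals all_analysis.
From mathcomp Require Import measurable_realfun.
From mathcomp Require Import ring lra.

Set Implicit Arguments.
Unset Strict Implicit.
Unset Printing Implicit Defensive.

Import Order.TTheory GRing.Theory Num.Theory.
Import numFieldNormedType.Exports.

Local Open Scope classical_set_scope.
Local Open Scope ring_scope.

(** * Normal laws on the line *)

Local Notation pushforward_measure :=
  measure_function_pushforward__canonical__measure_function_Measure.

(** Lebesgue measure is determined by its values on half-open intervals, and translation preserves
    their lengths. *)
Lemma lebesgue_measure_shift (R : realType) (c : R) (A : set R) :
  measurable A -> lebesgue_measure [set x | A (x + c)] = lebesgue_measure A.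
Proof.
move=> mA.
have mf : measurable_fun [set: measurableTypeR R]
    (fun x : measurableTypeR R => (x + c : measurableTypeR R)).
  exact: measurable_funD.
apply/esym; apply: (@lebesgue_measure_unique _
  (pushforward_measure lebesgue_measure mf)) => // _ [[a b] /= _ <-].
rewrite /pushforward /= (_ : _ @^-1` _ = `](a - c), (b - c)]%classic); last first.
  by apply/seteqP; split => x /=; rewrite !in_itv /= ltrBlDr lerBrDr.
rewrite !lebesgue_measure_itv /= !lte_fin ltrD2r.
by case: ifP => // _; rewrite -!EFinD; congr EFin; ring.
Qed.

Lemma lebesgue_measure_opp (R : realType) (A : set R) :
  measurable A -> lebesgue_measure [set x | A (- x)] = lebesgue_measure A.
Proof.
move=> mA.
have mf : measurable_fun [set: measurableTypeR R]
    (fun x : measurableTypeR R => (- x : measurableTypeR R)).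
  exact: measurableT_comp.
apply/esym; apply: (@lebesgue_measure_unique _
  (pushforward_measure lebesgue_measure mf)) => // _ [[a b] /= _ <-].
rewrite /pushforward /= (_ : _ @^-1` _ = `[(- b), (- a)[%classic); last first.
  by apply/seteqP; split => x /=; rewrite !in_itv /= ltrNr lerNl andbC.
rewrite !lebesgue_measure_itv /= !lte_fin ltrN2.
by case: ifP => // _; rewrite -!EFinD; congr EFin; ring.
Qed.

Lemma ge0_integral_lebesgue_comp (R : realType) (phi : R -> R) (f : R -> \bar R) :
  measurable_fun setT phi ->
  (forall A : set R, measurable A ->
     lebesgue_measure (phi @^-1` A) = lebesgue_measure A) ->
  measurable_fun setT f -> (forall x, 0 <= f x)%E ->
  (\int[lebesgue_measure]_x f (phi x) = \int[lebesgue_measure]_x f x)%E.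
Proof.
move=> mphi phiE mf f0.
have mphi' : @measurable_fun _ _ (measurableTypeR R) (measurableTypeR R) setT phi.
  by [].
rewrite -(@ge0_integral_pushforward _ _ _ _ _ _ mphi' lebesgue_measure setT)//.
by apply: (@eq_measure_integral _ _ _ _ _
  (pushforward_measure lebesgue_measure mphi')) => A mA _; rewrite /= -phiE.
Qed.

(** The change of variables holds for the Radon-Nikodym derivative, which is only fixed up to null
    sets and is then identified with [normal_pdf] almost everywhere. *)
Lemma integral_normal_prob (R : realType) (m s : R)
    (f : measurableTypeR R -> \bar R) :
  measurable_fun setT f -> (normal_prob m s).-integrable setT f ->
  (\int[normal_prob m s]_x f x =
   \int[lebesgue_measure]_x (f x * (normal_pdf m s x)%:E))%E.
Proof.
move=> mf fi; have dom := normal_prob_dominates m s.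
rewrite -(@Radon_Nikodym_change_of_variables _ _ _ (normal_prob m s)
  lebesgue_measure dom)//=.
apply: ae_eq_integral => //.
- exact: emeasurable_funM.
- apply: emeasurable_funM => //; apply/measurable_EFinP.
  exact: measurable_normal_pdf.
- apply: ae_eqe_mul2l => /=.
  rewrite Radon_NikodymE//=.
  case: cid => /= h [h1 h2 h3].
  apply: integral_ae_eq => //=.
  + by apply/measurable_EFinP; exact: measurable_normal_pdf.
  + by move=> E E01 mE; rewrite -h3.
Qed.

Lemma integrable_bounded (R : realType) d (T : measurableType d)
    (P : probability T R) (f : T -> R) (C : R) :
  measurable_fun setT f -> (forall x, `|f x| <= C) ->
  P.-integrable setT (EFin \o f).
Proof.
move=> mf fC; apply: measurable_bounded_integrable => //.
  by rewrite (le_lt_trans (probability_le1 P _))// ltry.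
exists C; split; first exact: num_real.
by move=> M CM y _; apply: le_trans (fC y) (ltW CM).
Qed.

Lemma integrable_scale (R : realType) d (T : measurableType d)
    (P : {measure set T -> \bar R}) (c : R) (f : T -> R) :
  P.-integrable setT (EFin \o f) -> P.-integrable setT (fun x => (c * f x)%:E).
Proof.
move=> fi; have := @integrableZl _ _ _ _ setT measurableT c _ fi.
by apply: eq_integrable => // x _; rewrite /= EFinM.
Qed.

Lemma normal_pdf_shift (R : realType) (m c s x : R) : s != 0 ->
  normal_pdf (m + c) s (x + c) = normal_pdf m s x.
Proof.
by move=> s0; rewrite !normal_pdfE//= /normal_fun opprD addrACA subrr addr0.
Qed.

Lemma normal_pdf_opp (R : realType) (s x : R) : s != 0 ->
  normal_pdf 0 s (- x) = normal_pdf 0 s x.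
Proof.
by move=> s0; rewrite !normal_pdfE//= /normal_fun !subr0 sqrrN.
Qed.

(* Completing the square in x; s' and m' are the conditional standard deviation and
   mean of x given x + y = z. *)
Lemma normal_pdf_mul (R : realType) (s1 s2 x z : R) : s1 != 0 -> s2 != 0 ->
  let s := Num.sqrt (s1 ^+ 2 + s2 ^+ 2) in
  let s' := s1 * s2 / s in
  let m' := z * (s1 ^+ 2 / s ^+ 2) in
  normal_pdf 0 s1 x * normal_pdf 0 s2 (z - x) =
  normal_pdf 0 s z * normal_pdf m' s' x.
Proof.
move=> s10 s20 s s' m'.
have v1 : 0 < s1 ^+ 2 by rewrite exprn_even_gt0.
have v2 : 0 < s2 ^+ 2 by rewrite exprn_even_gt0.
have s2E : s ^+ 2 = s1 ^+ 2 + s2 ^+ 2 by rewrite sqr_sqrtr// addr_ge0// ltW.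
have s_gt0 : 0 < s by rewrite sqrtr_gt0 addr_gt0.
have s0 : s != 0 by rewrite gt_eqF.
have s'0 : s' != 0 by rewrite !mulf_neq0// invr_neq0.
have s'2E : s' ^+ 2 = s1 ^+ 2 * s2 ^+ 2 / (s1 ^+ 2 + s2 ^+ 2).
  by rewrite /s' !exprMn exprVn s2E.
rewrite !normal_pdfE//= mulrACA [RHS]mulrACA; congr (_ * _).
  have p0 t : 0 <= t ^+ 2 * pi *+ 2 :> R.
    by rewrite mulrn_wge0// mulr_ge0 ?sqr_ge0 ?pi_ge0.
  rewrite /normal_peak -!invfM -(sqrtrM _ (p0 s1)) -(sqrtrM _ (p0 s)).
  congr (Num.sqrt _)^-1; rewrite s'2E s2E; field.
  by rewrite gt_eqF// addr_gt0.
rewrite /normal_fun -!expRD s'2E /m' s2E; congr expR; field.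
by rewrite s10 s20 gt_eqF// addr_gt0.
Qed.

(** After exchanging the integrals, completing the square splits off the conditional density of [x],
    which integrates to 1. Nonnegativity of [f] serves Tonelli, the bound [C] serves integrability
    under the normal laws. *)
Lemma normal_prob_convolution (R : realType) (s1 s2 C : R) (f : R -> R) :
  s1 != 0 -> s2 != 0 -> measurable_fun setT f ->
  (forall x, 0 <= f x) -> (forall x, f x <= C) ->
  (\int[normal_prob 0 s1]_x \int[normal_prob 0 s2]_y (f (x + y))%:E =
   \int[normal_prob 0 (Num.sqrt (s1 ^+ 2 + s2 ^+ 2))]_z (f z)%:E)%E.
Proof.
move=> s10 s20 mf f0 fC; set s := Num.sqrt _.
have fC' x : `|f x| <= C by rewrite ger0_norm.
have mfD (x : R) : measurable_fun setT (fun y : R => f (x + y)).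
  by apply: measurableT_comp => //; exact: measurable_funD.
have mEf (x : R) : measurable_fun setT (fun y : R => (f (x + y))%:E).
  exact/measurable_EFinP.
have mp t : measurable_fun setT (normal_pdf 0 t : R -> R).
  exact: measurable_normal_pdf.
have mF2 : measurable_fun setT (fun xz : R * R =>
    (f xz.2 * normal_pdf 0 s2 (xz.2 - xz.1))%:E).
  apply/measurable_EFinP; apply: measurable_funM; first exact: measurableT_comp.
  by apply: measurableT_comp => //; exact: measurable_funB.
have mF : measurable_fun setT (fun xz : R * R =>
    (f xz.2 * normal_pdf 0 s2 (xz.2 - xz.1))%:E * (normal_pdf 0 s1 xz.1)%:E)%E.
  apply: emeasurable_funM => //; apply/measurable_EFinP.
  exact: measurableT_comp.
have F20 x z : (0 <= (f z * normal_pdf 0 s2 (z - x))%:E)%E.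
  by rewrite lee_fin mulr_ge0// normal_pdf_ge0.
have innerE x : (\int[normal_prob 0 s2]_y (f (x + y))%:E =
    \int[lebesgue_measure]_z (f z * normal_pdf 0 s2 (z - x))%:E)%E.
  rewrite integral_normal_prob/=; last 2 first.
  - exact: mEf.
  - exact: (@integrable_bounded _ _ (measurableTypeR R) _ _ C (mfD x)).
  apply: etrans (ge0_integral_lebesgue_comp (phi := fun y => y + x)
    (f := fun z => (f z * normal_pdf 0 s2 (z - x))%:E) _ _ _ (F20 x)).
  - by apply: eq_integral => y _; rewrite /= addrK [x + y]addrC EFinM.
  - exact: measurable_funD.
  - by move=> A mA; exact: lebesgue_measure_shift.
  - apply/measurable_EFinP; apply: measurable_funM => //.
    by apply: measurableT_comp => //; exact: measurable_funB.
under eq_integral do rewrite innerE.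
pose G x := (\int[lebesgue_measure]_z (f z * normal_pdf 0 s2 (z - x))%:E)%E.
have G0 x : (0 <= G x)%E by apply: integral_ge0 => z _; exact: F20.
have mG : @measurable_fun _ _ (measurableTypeR R) _ setT G.
  exact: (@measurable_fun_fubini_tonelli_F _ _ (measurableTypeR R)
    (measurableTypeR R) _ lebesgue_measure _ mF2).
have GC x : (G x <= C%:E)%E.
  rewrite /G -innerE.
  apply: (@le_trans _ _ (\int[normal_prob 0 s2]_y (cst C%:E y))%E).
    apply: ge0_le_integral => //.
    - by move=> y _; rewrite lee_fin.
    - exact: mEf.
    - by move=> y _; rewrite lee_fin.
  by rewrite integral_cst//= probability_setT mule1.
rewrite (integral_normal_prob mG); last first.
  apply: (@le_integrable _ _ _ _ _ _ _ (cst C%:E)) => //.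
    by move=> x _; rewrite gee0_abs//= (le_trans (GC x))// lee_fin ler_norm.
  exact: finite_measure_integrable_cst.
transitivity (\int[lebesgue_measure]_x \int[lebesgue_measure]_z
    ((f z * normal_pdf 0 s2 (z - x))%:E * (normal_pdf 0 s1 x)%:E))%E.
  apply: eq_integral => x _; rewrite ge0_integralZr//.
  - apply/measurable_EFinP; apply: measurable_funM => //.
    by apply: measurableT_comp => //; exact: measurable_funB.
  - by rewrite lee_fin normal_pdf_ge0.
rewrite (@fubini_tonelli _ _ (measurableTypeR R) (measurableTypeR R) _
  lebesgue_measure lebesgue_measure _ mF)/=; last first.
  by move=> xz; rewrite mule_ge0// lee_fin normal_pdf_ge0.
rewrite integral_normal_prob/=; last 2 first.
- by have /measurable_EFinP := mf.
- exact: (@integrable_bounded _ _ (measurableTypeR R) _ _ C mf).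
apply: eq_integral => z _.
pose s' := s1 * s2 / s.
pose m' := z * (s1 ^+ 2 / s ^+ 2).
transitivity (\int[lebesgue_measure]_x
    ((f z * normal_pdf 0 s z)%:E * (normal_pdf m' s' x)%:E))%E.
  apply: eq_integral => x _; rewrite -!EFinM; congr EFin.
  by rewrite -!mulrA; congr (_ * _); rewrite mulrC; exact: normal_pdf_mul.
rewrite ge0_integralZl//.
- by rewrite integral_normal_pdf mule1 EFinM.
- by apply/measurable_EFinP; exact: measurable_normal_pdf.
- by move=> x _; rewrite lee_fin normal_pdf_ge0.
- by rewrite lee_fin mulr_ge0// normal_pdf_ge0.
Qed.

Lemma measurable_EFin_normal_pdf (R : realType) (m s : R) :
  measurable_fun [set: R] (fun x : R => (normal_pdf m s x)%:E).
Proof. by apply/measurable_EFinP; exact: measurable_normal_pdf. Qed.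

Lemma normal_prob_shift (R : realType) (m c s : R) (A : set R) :
  s != 0 -> measurable A ->
  normal_prob (m + c) s A = normal_prob m s [set x | A (x + c)].
Proof.
move=> s0 mA; rewrite /normal_prob [LHS]integral_mkcond [RHS]integral_mkcond.
rewrite -(@ge0_integral_lebesgue_comp _ (fun x => x + c)).
- by apply: eq_integral => x _; rewrite !patchE normal_pdf_shift.
- exact: measurable_funD.
- by move=> B mB; exact: lebesgue_measure_shift.
- apply: (measurable_restrictT _ mA).1; apply: measurable_funTS.
  exact: measurable_EFin_normal_pdf.
- by move=> x; rewrite patchE; case: ifP => // _; rewrite lee_fin normal_pdf_ge0.
Qed.

Lemma normal_prob_opp (R : realType) (s : R) (A : set R) :
  s != 0 -> measurable A ->
  normal_prob 0 s [set x | A (- x)] = normal_prob 0 s A.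
Proof.
move=> s0 mA; rewrite /normal_prob [LHS]integral_mkcond [RHS]integral_mkcond.
rewrite -[RHS](@ge0_integral_lebesgue_comp _ (fun x => - x)).
- by apply: eq_integral => x _; rewrite !patchE normal_pdf_opp.
- exact: measurableT_comp.
- by move=> B mB; exact: lebesgue_measure_opp.
- apply: (measurable_restrictT _ mA).1; apply: measurable_funTS.
  exact: measurable_EFin_normal_pdf.
- by move=> x; rewrite patchE; case: ifP => // _; rewrite lee_fin normal_pdf_ge0.
Qed.

Lemma gauss1_shift (R : realType) (m c v : R) (A : set R) :
  0 <= v -> measurable A -> gauss1 (m + c) v A = gauss1 m v [set x | A (x + c)].
Proof.
move=> v0 mA; rewrite /gauss1; case: ifPn => [_|vn0]; first by rewrite !diracE.
by apply: normal_prob_shift => //; rewrite gt_eqF// sqrtr_gt0 lt_neqAle eq_sym vn0.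
Qed.

Lemma Rintegral_law (R : realType) d d' (T : measurableType d)
    (T' : measurableType d') (P : probability T R) (Q : probability T' R)
    (U : T -> T') (f : T' -> R) (C : R) :
  measurable_fun setT U -> (forall A, measurable A -> P (U @^-1` A) = Q A) ->
  measurable_fun setT f -> (forall x, `|f x| <= C) ->
  \int[P]_w f (U w) = \int[Q]_x f x.
Proof.
move=> mU lawU mf fC; congr fine.
rewrite -(@integral_pushforward _ _ _ _ _ _ mU P setT (EFin \o f))//.
- by apply: (@eq_measure_integral _ _ _ _ _ (pushforward_measure P mU))
    => A mA _; exact: lawU.
- exact/measurable_EFinP.
- apply: (@integrable_bounded _ _ _ _ _ C) => //.
  exact: measurableT_comp.
Qed.

(* The characteristic function of N(0, v) at 1. The case v = 0 is separate because
   [normal_prob] at standard deviation 0 is not a point mass. *)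
Definition gauss_cos (R : realType) (v : R) : R :=
  if v == 0 then 1 else \int[normal_prob 0 (Num.sqrt v)]_x cos x.

Lemma cos_abs_le1 (R : realType) (x : R) : `|cos x| <= 1.
Proof. by rewrite ler_norml cos_geN1 cos_le1. Qed.

Lemma sin_abs_le1 (R : realType) (x : R) : `|sin x| <= 1.
Proof. by rewrite ler_norml sin_geN1 sin_le1. Qed.

Lemma measurable_cos (R : realType) : measurable_fun [set: R] (@cos R).
Proof. by apply: continuous_measurable_fun; exact: continuous_cos. Qed.

Lemma measurable_sin (R : realType) : measurable_fun [set: R] (@sin R).
Proof. by apply: continuous_measurable_fun; exact: continuous_sin. Qed.

(** The law is symmetric and the sine is odd, so the integral equals its opposite. *)
Lemma Rintegral_normal_sin (R : realType) (s : R) : s != 0 ->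
  \int[normal_prob 0 s]_x sin x = 0.
Proof.
have dbl (a : R) : a + a = 0 -> a = 0 by move=> ?; lra.
move=> s0.
have mopp : @measurable_fun _ _ (measurableTypeR R) (measurableTypeR R) setT
    (fun x => - x).
  by apply: (@measurableT_comp _ _ _ _ _ _ (@GRing.opp R) _ id).
have sin_opp : \int[normal_prob 0 s]_x sin (- x) = \int[normal_prob 0 s]_x sin x.
  apply: (@Rintegral_law _ _ _ (measurableTypeR R) (measurableTypeR R)
    _ _ _ _ 1) => //.
  - by move=> A mA; exact: normal_prob_opp.
  - exact: measurable_sin.
  - exact: sin_abs_le1.
apply: dbl.
rewrite -{1}sin_opp -RintegralD//.
- by under eq_Rintegral do rewrite sinN addNr; rewrite Rintegral_cst// mul0r.
- apply: (@integrable_bounded _ _ (measurableTypeR R) _ _ 1).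
    by apply: measurableT_comp => //; exact: measurable_sin.
  by move=> x; exact: sin_abs_le1.
- apply: (@integrable_bounded _ _ (measurableTypeR R) _ _ 1).
    exact: measurable_sin.
  exact: sin_abs_le1.
Qed.

Lemma integrable_normal_cos (R : realType) (m s c : R) :
  (normal_prob m s).-integrable setT (fun x => (cos (x + c))%:E).
Proof.
apply: (@integrable_bounded _ _ (measurableTypeR R) _ (fun x : R => cos (x + c)) 1).
  apply: (measurableT_comp (@measurable_cos R)); exact: measurable_funD.
by move=> x; exact: cos_abs_le1.
Qed.

Lemma integrable_normal_sin (R : realType) (m s c : R) :
  (normal_prob m s).-integrable setT (fun x => (sin (x + c))%:E).
Proof.
apply: (@integrable_bounded _ _ (measurableTypeR R) _ (fun x : R => sin (x + c)) 1).
  apply: (measurableT_comp (@measurable_sin R)); exact: measurable_funD.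
by move=> x; exact: sin_abs_le1.
Qed.

Lemma Rintegral_normal_cosD (R : realType) (s c : R) : s != 0 ->
  \int[normal_prob 0 s]_x cos (x + c) = cos c * \int[normal_prob 0 s]_x cos x.
Proof.
move=> s0.
have ic : (normal_prob 0 s).-integrable setT (fun x => (cos x)%:E).
  by have := integrable_normal_cos 0 s 0; under eq_fun do rewrite addr0.
have is' : (normal_prob 0 s).-integrable setT (fun x => (sin x)%:E).
  by have := integrable_normal_sin 0 s 0; under eq_fun do rewrite addr0.
under eq_Rintegral do rewrite cosD [cos _ * cos c]mulrC [sin _ * sin c]mulrC.
rewrite RintegralB//.
- by rewrite !RintegralZl// Rintegral_normal_sin// mulr0 subr0.
- exact: integrable_scale ic.
- exact: integrable_scale is'.
Qed.

Lemma integral_prob_add1 (R : realType) d (T : measurableType d)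
    (P : probability T R) (h : T -> R) :
  P.-integrable setT (EFin \o h) ->
  (\int[P]_x (1 + h x)%:E = (1 + \int[P]_x h x)%:E)%E.
Proof.
move=> ih; under eq_integral do rewrite EFinD.
rewrite integralD//; last exact: finite_measure_integrable_cst.
rewrite integral_cst//= probability_setT mule1 EFinD fineK//.
exact: integrable_fin_num.
Qed.

(** Characteristic functions are multiplicative under convolution: integrating [cos (x + y)] over
    [y] first gives a multiple of [cos x]. *)
Lemma gauss_cosD (R : realType) (v1 v2 : R) : 0 <= v1 -> 0 <= v2 ->
  gauss_cos (v1 + v2) = gauss_cos v1 * gauss_cos v2.
Proof.
move=> v1_ge0 v2_ge0; rewrite /gauss_cos.
have [->|v1n0] := eqVneq v1 0; first by rewrite add0r mul1r.
have [->|v2n0] := eqVneq v2 0; first by rewrite addr0 (negbTE v1n0) mulr1.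
have v1_gt0 : 0 < v1 by rewrite lt_neqAle eq_sym v1n0.
have v2_gt0 : 0 < v2 by rewrite lt_neqAle eq_sym v2n0.
rewrite gt_eqF ?addr_gt0//.
set s1 := Num.sqrt v1; set s2 := Num.sqrt v2.
have s10 : s1 != 0 by rewrite gt_eqF// sqrtr_gt0.
have s20 : s2 != 0 by rewrite gt_eqF// sqrtr_gt0.
have ic m s : (normal_prob m s).-integrable setT (fun x : R => (cos x)%:E).
  by have := integrable_normal_cos m s 0; under eq_fun do rewrite addr0.
(* The convolution formula is stated for nonnegative functions, so it is applied to [1 + cos], which
   lies between 0 and 2; the 1 cancels at the end. *)
have f0 (x : R) : 0 <= 1 + cos x by have := cos_geN1 x; lra.
have f2 (x : R) : 1 + cos x <= 2 by have := cos_le1 x; lra.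
have mf : measurable_fun [set: R] (fun x : R => 1 + cos x).
  by apply: measurable_funD => //; exact: measurable_cos.
have := normal_prob_convolution s10 s20 mf f0 f2.
have -> : s1 ^+ 2 + s2 ^+ 2 = v1 + v2 by rewrite /s1 /s2 !sqr_sqrtr.
move=> conv.
pose g2 := \int[normal_prob 0 s2]_x cos x.
have icg2 : (normal_prob 0 s1).-integrable setT (fun x : R => (g2 * cos x)%:E).
  exact: integrable_scale (ic 0 s1).
have L : (\int[normal_prob 0 s1]_x \int[normal_prob 0 s2]_y (1 + cos (x + y))%:E =
    (1 + \int[normal_prob 0 s1]_x (g2 * cos x))%:E)%E.
  apply: etrans (integral_prob_add1 icg2); apply: eq_integral => x _.
  transitivity (\int[normal_prob 0 s2]_y (1 + cos (y + x))%:E)%E.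
    by apply: eq_integral => y _; rewrite [x + y]addrC.
  apply: etrans (integral_prob_add1 (integrable_normal_cos 0 s2 x)) _.
  by rewrite [g2 * _]mulrC; congr (1 + _)%:E; exact: Rintegral_normal_cosD.
have E := etrans (esym L) (etrans conv
  (integral_prob_add1 (ic 0 (Num.sqrt (v1 + v2))))).
apply: etrans (esym (@addrI _ 1 _ _ (EFin_inj E))) _; rewrite [RHS]mulrC.
by apply: RintegralZl; [exact: measurableT|exact: ic].
Qed.

(** Centring the law moves the mean into the phase, and the addition formula turns the phase into
    the factor [cos (m + c)]. *)
Lemma Rintegral_gauss1_cos (R : realType) d (T : measurableType d)
    (P : probability T R) (U : T -> R) (m v c : R) :
  measurable_fun setT U -> 0 <= v ->
  (forall A, measurable A -> P (U @^-1` A) = gauss1 m v A) ->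
  \int[P]_w cos (U w + c) = cos (m + c) * gauss_cos v.
Proof.
move=> mU v0 lawU.
have mcos : measurable_fun [set: R] (fun x : R => cos (x + c)).
  by apply: (measurableT_comp (@measurable_cos R)); exact: measurable_funD.
have cos1 (x : R) : `|cos (x + c)| <= 1 by exact: cos_abs_le1.
rewrite /gauss_cos; have [v_eq0|vn0] := eqVneq v 0.
  rewrite mulr1.
  have lawU' (A : set R) : measurable A -> P (U @^-1` A) = \d_m A.
    by move=> mA; rewrite lawU// /gauss1 v_eq0 eqxx.
  apply: etrans (Rintegral_law mU lawU' mcos cos1) _.
  rewrite /Rintegral integral_dirac//; last exact/measurable_EFinP.
  by rewrite diracT mul1e.
have s0 : Num.sqrt v != 0 by rewrite gt_eqF// sqrtr_gt0 lt_neqAle eq_sym vn0.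
set s := Num.sqrt v in s0 *.
have lawU' (A : set (measurableTypeR R)) : measurable A ->
    P (U @^-1` A) = normal_prob m s A.
  by move=> mA; rewrite lawU// /gauss1 (negbTE vn0).
have mU' : @measurable_fun _ _ T (measurableTypeR R) setT U by [].
have mcos' : @measurable_fun _ _ (measurableTypeR R) R setT (fun x => cos (x + c)).
  by [].
apply: etrans (Rintegral_law mU' lawU' mcos' cos1) _.
have mshift : @measurable_fun _ _ (measurableTypeR R) (measurableTypeR R) setT
  (fun x => x + m) by exact: measurable_funD.
have law_shift (A : set (measurableTypeR R)) : measurable A ->
    normal_prob 0 s ((fun x => x + m) @^-1` A) = normal_prob m s A.
  by move=> mA; rewrite -[in RHS](add0r m) normal_prob_shift.
apply: etrans (esym (Rintegral_law mshift law_shift mcos' cos1)) _.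
by under eq_Rintegral do rewrite -addrA; exact: Rintegral_normal_cosD.
Qed.

(** * Bounded pointwise closure *)

(** The setting of a functional monotone class argument: each property is proved by induction over
    the closure. In [bp_lim] the bound [C] is uniform in the index and the point, so that dominated
    convergence applies. *)
Inductive bp_closure (T : Type) (R : realType) (A : set (T -> R)) :
    set (T -> R) :=
| bp_base f : A f -> bp_closure A f
| bp_lin (c : R) f g : bp_closure A f -> bp_closure A g ->
    bp_closure A (fun x => c * f x + g x)
| bp_lim (F : nat -> T -> R) (f : T -> R) (C : R) :
    (forall k, bp_closure A (F k)) -> (forall k x, `|F k x| <= C) ->
    (forall x, F ^~ x @ \oo --> f x) -> bp_closure A f.

Section bp_closure.
Context (T : Type) (R : realType) (A : set (T -> R)).
Hypothesis A_bounded : forall f, A f -> exists C : R, forall x, `|f x| <= C.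
Local Notation bp := (bp_closure A).

Lemma bp_bounded f : bp f -> exists C : R, forall x, `|f x| <= C.
Proof.
elim=> {f} [f /A_bounded//|c f g _ [Cf fC] _ [Cg gC]|F f C _ _ FC Ff].
  exists (`|c| * Cf + Cg) => x; rewrite (le_trans (ler_normD _ _))// lerD//.
  by rewrite normrM ler_wpM2l.
exists C => x.
have cF : `|F n x| @[n --> \oo] --> `|f x| by exact: cvg_norm (Ff x).
rewrite -(cvg_lim (@Rhausdorff R) cF); apply: limr_le; first exact: cvgP cF.
exact: nearW.
Qed.

Lemma bp_eq f g : bp f -> f =1 g -> bp g.
Proof. by move=> bf /funext <-. Qed.

Hypothesis bp1 : bp (fun=> 1).

Lemma bp_cst c : bp (fun=> c).
(* Only the constant 1 is given, so [c] is obtained as [(c - 1) * 1 + 1]. *)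
Proof. by apply: bp_eq (bp_lin (c - 1) bp1 bp1) _ => x; rewrite mulr1 subrK. Qed.

Lemma bpZ c f : bp f -> bp (fun x => c * f x).
Proof.
by move=> bf; apply: bp_eq (bp_lin c bf (bp_cst 0)) _ => x; rewrite addr0.
Qed.

Lemma bpD f g : bp f -> bp g -> bp (fun x => f x + g x).
Proof. by move=> bf bg; apply: bp_eq (bp_lin 1 bf bg) _ => x; rewrite mul1r. Qed.

Lemma bpB f g : bp f -> bp g -> bp (fun x => f x - g x).
Proof.
move=> bf bg; apply: bp_eq (bp_lin (-1) bg bf) _ => x.
by rewrite mulN1r addrC.
Qed.

Hypothesis A_mul : forall f g, A f -> A g -> bp (fun x => f x * g x).

(** Products need only be known for generators: induction on [f], and in its base case a second
    induction on [g]. *)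
Lemma bpM f g : bp f -> bp g -> bp (fun x => f x * g x).
Proof.
(* Multiplication by a fixed bounded [h] preserves uniformly bounded limits; both inductions use
   this. *)
have limM (h : T -> R) (F : nat -> T -> R) (k : T -> R) (C : R) :
    bp h -> (forall n, bp (fun x => F n x * h x)) -> (forall n x, `|F n x| <= C) ->
    (forall x, F ^~ x @ \oo --> k x) -> bp (fun x => k x * h x).
  move=> /bp_bounded[D hD] bF FC Fk.
  apply: (@bp_lim _ _ _ (fun n x => F n x * h x) _ (C * D)) => // [n x|x].
    by rewrite normrM ler_pM.
  exact: cvgMl.
move=> bf bg; elim: bf => {f} [f Af|c f1 f2 _ IH1 _ IH2|F f C _ IH FC Ff].
- elim: bg => {g} [g /(A_mul Af)//|c g1 g2 _ IH1 _ IH2|F g C _ IH FC Fg].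
    by apply: bp_eq (bp_lin c IH1 IH2) _ => x; ring.
  apply: (@bp_eq (fun x => g x * f x)) => [|x]; last exact: mulrC.
  apply: (@limM f F g C) => //; first exact: bp_base.
  by move=> n; apply: bp_eq (IH n) _ => x; rewrite mulrC.
- by apply: bp_eq (bp_lin c IH1 IH2) _ => x; ring.
- exact: (@limM g F f C).
Qed.

(* On [-1, 1] the iterates of the odd polynomial (3y - y^3)/2 converge to the sign
   function, since 1 attracts ]0, 1]. *)
Let sgn_step (y : R) := 2^-1 * (3 * y - y ^+ 3).

Let sgn_step_ge (y : R) : 0 <= y <= 1 -> y <= sgn_step y <= 1.
Proof.
move=> /andP[y0 y1]; apply/andP; split; rewrite -subr_ge0.
  have -> : sgn_step y - y = y * (1 - y) * (1 + y) / 2 by rewrite /sgn_step; field.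
  by rewrite !mulr_ge0 ?invr_ge0//; lra.
have -> : 1 - sgn_step y = (1 - y) ^+ 2 * (2 + y) / 2 by rewrite /sgn_step; field.
by rewrite !mulr_ge0 ?invr_ge0 ?sqr_ge0//; lra.
Qed.

(** Above [y0] the distance to 1 shrinks by the fixed factor [1 - y0 / 2]. As the iterates increase,
    they stay above their starting point, and the convergence is geometric. *)
Let sgn_step_dist (y0 y : R) : 0 <= y0 -> y0 <= y <= 1 ->
  1 - sgn_step y <= (1 - y0 / 2) * (1 - y).
Proof.
move=> y00 /andP[y0y y1]; rewrite -subr_ge0.
have -> : (1 - y0 / 2) * (1 - y) - (1 - sgn_step y) =
    (1 - y) * ((y - y0) + y ^+ 2) / 2 by rewrite /sgn_step; field.
have h1 : 0 <= 1 - y by lra.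
have h2 : 0 <= (y - y0) + y ^+ 2 by rewrite addr_ge0 ?sqr_ge0// subr_ge0.
by rewrite !mulr_ge0 ?invr_ge0.
Qed.

Let iter_sgn_step_pos (y0 : R) n : 0 <= y0 <= 1 ->
  y0 <= iter n sgn_step y0 <= 1 /\
  1 - iter n sgn_step y0 <= (1 - y0 / 2) ^+ n.
Proof.
move=> /andP[y00 y01]; elim: n => [|n [/andP[IH1 IH2] IH3]] /=.
  by rewrite lexx y01 expr0; split => //; lra.
have := @sgn_step_ge (iter n sgn_step y0); rewrite (le_trans y00 IH1) IH2.
move=> /(_ isT)/andP[h1 h2]; split; first by rewrite h2 (le_trans IH1 h1).
apply: (le_trans (@sgn_step_dist y0 _ _ _)) => //; first by rewrite IH1.
by rewrite exprS ler_wpM2l//; lra.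
Qed.

Let sgn_stepN y : sgn_step (- y) = - sgn_step y.
Proof. by rewrite /sgn_step; ring. Qed.

Let iter_sgn_stepN n y : iter n sgn_step (- y) = - iter n sgn_step y.
Proof. by elim: n => //= n ->; rewrite sgn_stepN. Qed.

Let cvg_iter_sgn_step_pos (y : R) : 0 < y <= 1 ->
  iter n sgn_step y @[n --> \oo] --> (1 : R).
Proof.
move=> /andP[y0 y1].
have y01 : 0 <= y <= 1 by rewrite ltW.
have c0 : (1 - y / 2) ^+ n @[n --> \oo] --> (0 : R).
  by apply: cvg_expr; rewrite ger0_norm; lra.
have c1 : 1 - (1 - y / 2) ^+ n @[n --> \oo] --> (1 : R).
  by rewrite -[X in _ --> X]subr0; apply: cvgB => //; exact: cvg_cst.
apply: (squeeze_cvgr _ c1 (cvg_cst (1 : R))); apply: nearW => n.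
by have [/andP[_ ->] h] := iter_sgn_step_pos n y01; rewrite andbT; lra.
Qed.

Let cvg_iter_sgn_step (y : R) : `|y| <= 1 ->
  iter n sgn_step y @[n --> \oo] --> Num.sg y.
Proof.
move=> y1; have [y0|y0|->] := ltrgtP y 0.
- rewrite ltr0_sg//.
  have -> : (fun n => iter n sgn_step y) = (fun n => - iter n sgn_step (- y)).
    by apply/funext => n; rewrite iter_sgn_stepN opprK.
  apply: cvgN; apply: cvg_iter_sgn_step_pos.
  by rewrite oppr_gt0 y0/= -(ltr0_norm y0).
- rewrite gtr0_sg//; apply: cvg_iter_sgn_step_pos.
  by rewrite y0/= -(gtr0_norm y0).
- rewrite sgr0; apply: cvg_near_cst; apply: nearW => n.
  by elim: n => //= n ->; rewrite /sgn_step; ring.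
Qed.

Let iter_sgn_step_le1 (y : R) n : `|y| <= 1 -> `|iter n sgn_step y| <= 1.
Proof.
have pos z : 0 <= z <= 1 -> `|iter n sgn_step z| <= 1.
  move=> z01; have [/andP[h1 h2] _] := iter_sgn_step_pos n z01.
  by rewrite ger0_norm// (le_trans _ h1)//; case/andP: z01.
have [y0 y1|y0] := leP 0 y; first by rewrite pos// y0 -(ger0_norm y0).
move=> y1; rewrite -[y]opprK iter_sgn_stepN normrN pos//.
by rewrite oppr_ge0 ltW//= -(ltr0_norm y0).
Qed.

(** Each iterate is a polynomial in [f], hence lies in the closure; the bound on [f] keeps its
    values where the iterates converge to the sign. *)
Lemma bp_sg f : bp f -> (forall x, `|f x| <= 1) -> bp (fun x => Num.sg (f x)).
Proof.
move=> bf f1.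
apply: (@bp_lim _ _ _ (fun n x => iter n sgn_step (f x)) _ 1).
- elim=> [|n IH] //=; rewrite /sgn_step; apply: bpZ; apply: bpB; first exact: bpZ.
  by apply: bp_eq (bpM IH (bpM IH IH)) _ => x; rewrite !exprS expr0 mulr1.
- by move=> n x; exact: iter_sgn_step_le1.
- by move=> x; exact: cvg_iter_sgn_step.
Qed.

(** Complements correspond to [1 - \1_S], intersections to products, and countable unions to limits
    of finite ones. *)
Lemma bp_sigma_algebra : sigma_algebra setT [set S | bp (\1_S)].
Proof.
have indicE S : (\1_S : T -> R) = fun x => (x \in S)%:R by [].
have bpC S : bp (\1_S) -> bp (\1_(~` S)).
  move=> bS; apply: bp_eq (bpB bp1 bS) _ => x; rewrite !indicE in_setC.
  by case: (x \in S); rewrite /= ?subrr ?subr0.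
have bpI S S' : bp (\1_S) -> bp (\1_S') -> bp (\1_(S `&` S')).
  move=> bS bS'; apply: bp_eq (bpM bS bS') _ => x; rewrite !indicE in_setI.
  by rewrite -natrM mulnb.
split => /=.
- by apply: bp_eq (bp_cst 0) _ => x; rewrite indicE in_set0.
- by move=> S bS; rewrite setTD; exact: bpC.
- move=> S bS.
  have bU n : bp (\1_(\bigcup_(k < n) S k)).
    elim: n => [|n IH].
      apply: bp_eq (bp_cst 0) _ => x.
      by rewrite bigcup_mkord big_ord0 indicE in_set0.
    rewrite bigcup_mkord big_ord_recr/= -bigcup_mkord -[X in \1_X]setCK setCU.
    by apply: (bpC); apply: bpI; exact: (bpC).
  apply: (@bp_lim _ _ _ (fun n => \1_(\bigcup_(k < n) S k)) _ 1) => //.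
    by move=> n x; rewrite indicE ger0_norm ?ler0n//; case: (_ \in _).
  (* At each point the indicators are eventually constant: from the first [n] beyond an index [k]
     with [S k x], or always if there is none. *)
  move=> x; apply: cvg_near_cst; have [[k _ Skx]|nSx] := pselect ((\bigcup_k S k) x).
    near=> n; rewrite !indicE !mem_set//; first by exists k.
    by exists k => //=; near: n; exact: nbhs_infty_gt.
  apply: nearW => n; rewrite !indicE !memNset// => -[k _ Skx].
  by apply: nSx; exists k.
Unshelve. all: by end_near. Qed.

End bp_closure.

(** * Factorisation of expectations along the closure *)

Lemma bounded_cvg_Rintegral (R : realType) d (T : measurableType d)
    (P : probability T R) (F : nat -> T -> R) (f : T -> R) (C : R) :
  (forall n, measurable_fun setT (F n)) -> (forall n x, `|F n x| <= C) ->
  (forall x, F ^~ x @ \oo --> f x) ->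
  \int[P]_x F n x @[n --> \oo] --> \int[P]_x f x.
Proof.
move=> mF FC Ff.
have mf : measurable_fun setT f by apply: (measurable_fun_cvg mF) => x _.
have [|||||fi _ cF] := @dominated_convergence _ _ _ P setT measurableT
  (fun n x => (F n x)%:E) (fun x => (f x)%:E) (cst C%:E).
- by move=> n; apply/measurable_EFinP.
- exact/measurable_EFinP.
- by apply: aeW => x _; apply: cvg_EFin; [exact: nearW|exact: Ff].
- exact: finite_measure_integrable_cst.
- by apply: aeW => x n _; rewrite lee_fin.
apply: (fine_cvg (F := \oo) (f := fun n => \int[P]_x (F n x)%:E)%E).
by rewrite fineK//; exact: integrable_fin_num.
Qed.

Lemma bp_measurable (R : realType) d (T : measurableType d)
    (A : set (T -> R)) (f : T -> R) :
  (forall f, A f -> measurable_fun setT f) ->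
  bp_closure A f -> measurable_fun setT f.
Proof.
move=> mA; elim=> {f} [f /mA//|c f g _ mf _ mg|F f C _ mF _ Ff].
  by apply: measurable_funD => //; exact: measurable_funM.
by apply: (measurable_fun_cvg mF) => x _.
Qed.

Section bp_integral.
Context (R : realType) (d : measure_display) (Omega : measurableType d)
  (P : probability Omega R).

(** With the second factor fixed, both sides are linear in [f] and pass to bounded limits by
    dominated convergence. *)
Lemma bp_Rintegral_mul d' (T : measurableType d') (A : set (T -> R))
    (X : Omega -> T) (Y : Omega -> R) (C : R) (f : T -> R) :
  (forall f, A f -> measurable_fun setT f) ->
  (forall f, A f -> exists C : R, forall x, `|f x| <= C) ->
  measurable_fun setT X -> measurable_fun setT Y -> (forall w, `|Y w| <= C) ->
  (forall f, A f -> \int[P]_w (f (X w) * Y w) =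
                    (\int[P]_w f (X w)) * \int[P]_w Y w) ->
  bp_closure A f ->
  \int[P]_w (f (X w) * Y w) = (\int[P]_w f (X w)) * \int[P]_w Y w.
Proof.
move=> mA bA mX mY YC AY.
have mfX f' : bp_closure A f' -> measurable_fun setT (fun w => f' (X w)).
  by move=> /(bp_measurable mA) mf'; exact: (measurableT_comp mf').
have mfXY f' : bp_closure A f' -> measurable_fun setT (fun w => f' (X w) * Y w).
  by move=> bf'; apply: measurable_funM => //; exact: mfX.
have fXi f' : bp_closure A f' -> P.-integrable setT (fun w => (f' (X w))%:E).
  move=> bf'; have [D fD] := bp_bounded bA bf'.
  exact: (integrable_bounded P (mfX _ bf') (fun w => fD (X w))).
have fXYi f' : bp_closure A f' -> P.-integrable setT (fun w => (f' (X w) * Y w)%:E).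
  move=> bf'; have [D fD] := bp_bounded bA bf'.
  have fYD w : `|f' (X w) * Y w| <= D * C by rewrite normrM ler_pM.
  exact: (integrable_bounded P (mfXY _ bf') fYD).
elim=> {f} [f /AY//|c f g bf IHf bg IHg|F f D bF IH FD Ff].
- transitivity (\int[P]_w (c * (f (X w) * Y w) + g (X w) * Y w)).
    by apply: eq_Rintegral => w _; rewrite mulrDl mulrA.
  have fZi := integrable_scale c (fXi _ bf).
  have fYZi := integrable_scale c (fXYi _ bf).
  rewrite (RintegralD measurableT fYZi (fXYi _ bg)).
  rewrite (RintegralD measurableT fZi (fXi _ bg)).
  rewrite (RintegralZl _ measurableT (fXYi _ bf)).
  rewrite (RintegralZl _ measurableT (fXi _ bf)).
  by rewrite IHf IHg; ring.
- have cXY : \int[P]_w (F n (X w) * Y w) @[n --> \oo] --> \int[P]_w (f (X w) * Y w).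
    apply: (@bounded_cvg_Rintegral _ _ _ _ _ _ (D * C)).
    + by move=> n; exact: mfXY.
    + by move=> n w; rewrite normrM ler_pM.
    + by move=> w; apply: cvgMl; exact: Ff.
  have cX : \int[P]_w F n (X w) @[n --> \oo] --> \int[P]_w f (X w).
    apply: (@bounded_cvg_Rintegral _ _ _ _ _ _ D) => //.
    by move=> n; exact: mfX.
  have cX' : \int[P]_w F n (X w) * \int[P]_w Y w @[n --> \oo] -->
      \int[P]_w f (X w) * \int[P]_w Y w by exact: cvgMl.
  apply: cvg_unique cXY _ => //.
  rewrite (_ : (fun n => _) = (fun n => \int[P]_w F n (X w) * \int[P]_w Y w))//.
  exact/funext.
Qed.

Lemma bp_Rintegral_indep d1 (T1 : measurableType d1) d2 (T2 : measurableType d2)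
    (A1 : set (T1 -> R)) (A2 : set (T2 -> R)) (X1 : Omega -> T1)
    (X2 : Omega -> T2) (f : T1 -> R) (g : T2 -> R) :
  (forall f, A1 f -> measurable_fun setT f) ->
  (forall f, A1 f -> exists C : R, forall x, `|f x| <= C) ->
  (forall f, A2 f -> measurable_fun setT f) ->
  (forall f, A2 f -> exists C : R, forall x, `|f x| <= C) ->
  measurable_fun setT X1 -> measurable_fun setT X2 ->
  (forall f g, A1 f -> A2 g -> \int[P]_w (f (X1 w) * g (X2 w)) =
     (\int[P]_w f (X1 w)) * \int[P]_w g (X2 w)) ->
  bp_closure A1 f -> bp_closure A2 g ->
  \int[P]_w (f (X1 w) * g (X2 w)) = (\int[P]_w f (X1 w)) * \int[P]_w g (X2 w).
Proof.
move=> mA1 bA1 mA2 bA2 mX1 mX2 A12 bf bg.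
have [C gC] := bp_bounded bA2 bg.
(* The factors are extended one at a time: first [f] against the fixed [g (X2 w)]; what remains is
   [f'] in [A1] against [g], where the roles are exchanged. *)
apply: (@bp_Rintegral_mul _ _ A1 _ (fun w => g (X2 w)) C) => // [|f' A1f'].
  by have := bp_measurable mA2 bg => mg; exact: measurableT_comp.
have [C' fC'] := bA1 _ A1f'.
under eq_Rintegral do rewrite mulrC.
rewrite mulrC; apply: (@bp_Rintegral_mul _ _ A2 _ (fun w => f' (X1 w)) C')
  => // [|g' A2g'].
  by have := mA1 _ A1f' => mf; exact: measurableT_comp.
by under eq_Rintegral do rewrite mulrC; rewrite mulrC A12.
Qed.

End bp_integral.

(** * Cosines of linear functionals of a matrix *)

Lemma mxtrace_tr_mulE (R : realType) m n (a x : 'M[R]_(m, n)) :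
  \tr (a^T *m x) = \sum_i \sum_j a i j * x i j.
Proof.
rewrite /mxtrace; under eq_bigr do rewrite mxE.
by rewrite exchange_big; do 2!apply: eq_bigr => ? _; rewrite !mxE.
Qed.

Lemma mxtrace_tr_mulDl (R : realType) m n (a b x : 'M[R]_(m, n)) :
  \tr ((a + b)^T *m x) = \tr (a^T *m x) + \tr (b^T *m x).
Proof. by rewrite linearD/= mulmxDl mxtraceD. Qed.

Lemma mxtrace_tr_mulNl (R : realType) m n (a x : 'M[R]_(m, n)) :
  \tr ((- a)^T *m x) = - \tr (a^T *m x).
Proof. by rewrite linearN/= mulNmx linearN. Qed.

Lemma measurable_mxtrace_mul (R : realType) m n (a : 'M[R]_(m, n)) :
  measurable_fun setT (fun x : 'M[R]_(m, n) => \tr (a^T *m x)).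
Proof.
under eq_fun do rewrite mxtrace_tr_mulE.
apply: measurable_sum => i; apply: measurable_sum => j.
by apply: measurable_funM => //; exact: measurable_coord.
Qed.

Section mxcos.
Context (R : realType) (m n : nat).

(** The trace is the entrywise inner product. The phase [c] provides sines as well, and by the
    product-to-sum formula products are again linear combinations of such functions. *)
Definition mxcos : set ('M[R]_(m, n) -> R) :=
  [set f | exists a c, f = fun x => cos (\tr (a^T *m x) + c)].

Lemma mxcos_bounded f : mxcos f -> exists C : R, forall x, `|f x| <= C.
Proof. by move=> [a [c ->]]; exists 1 => x; exact: cos_abs_le1. Qed.

Lemma mxcos_measurable f : mxcos f -> measurable_fun setT f.
Proof.
move=> [a [c ->]]; apply: (measurableT_comp (@measurable_cos R)).
by apply: measurable_funD => //; exact: measurable_mxtrace_mul.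
Qed.

Lemma bp_mxcos1 : bp_closure mxcos (fun=> 1).
Proof.
apply: bp_base; exists 0, 0; apply/funext => x.
by rewrite trmx0 mul0mx mxtrace0 addr0 cos0.
Qed.

Lemma bp_mxcos_mul f g : mxcos f -> mxcos g ->
  bp_closure mxcos (fun x => f x * g x).
Proof.
move=> [a [c ->]] [b [e ->]].
have bD : bp_closure mxcos (fun x => cos (\tr ((a + b)^T *m x) + (c + e))).
  by apply: bp_base; exists (a + b), (c + e).
have bB : bp_closure mxcos (fun x => cos (\tr ((a - b)^T *m x) + (c - e))).
  by apply: bp_base; exists (a - b), (c - e).
apply: bp_eq (bpZ bp_mxcos1 2^-1 (bpD bD bB)) _ => x.
set u := \tr (a^T *m x) + c; set v := \tr (b^T *m x) + e.
have -> : \tr ((a + b)^T *m x) + (c + e) = u + v.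
  by rewrite mxtrace_tr_mulDl addrACA.
have -> : \tr ((a - b)^T *m x) + (c - e) = u - v.
  by rewrite mxtrace_tr_mulDl mxtrace_tr_mulNl opprD addrACA.
by rewrite cosD cosB; field.
Qed.

Let bpM := bpM mxcos_bounded bp_mxcos_mul.
Let bp_sg := bp_sg mxcos_bounded bp_mxcos1 bp_mxcos_mul.
Let bp_sigma := bp_sigma_algebra mxcos_bounded bp_mxcos1 bp_mxcos_mul.

(** The sine of [(x i j - c) / (k + 1)] has the sign of [x i j - c] once its argument lies strictly
    between [-pi] and [pi], which holds for large [k]. *)
Lemma bp_mxcos_sg i j (c : R) :
  bp_closure mxcos (fun x : 'M[R]_(m, n) => Num.sg (x i j - c)).
Proof.
pose s k (x : 'M[R]_(m, n)) : R := sin (k.+1%:R^-1 * (x i j - c)).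
have bs k : bp_closure mxcos (s k).
  (* The phase [- pi / 2] turns the cosine into a sine, and the scaled [delta_mx i j] selects one
     coordinate. *)
  apply: bp_base; exists (k.+1%:R^-1 *: delta_mx i j), (- (k.+1%:R^-1 * c) - pi / 2).
  apply/funext => x; rewrite addrA cosBpihalf mxtrace_tr_mulE /s.
  congr (sin _); rewrite mulrBr; congr (_ - _).
  rewrite (bigD1 i)//= (bigD1 j)//= !mxE !eqxx mulr1.
  rewrite big1 ?addr0 => [|j' /negbTE j'j]; last first.
    by rewrite !mxE j'j andbF mulr0 mul0r.
  rewrite big1 ?addr0// => i' /negbTE i'i; rewrite big1// => j' _.
  by rewrite !mxE i'i mulr0 mul0r.
apply: (@bp_lim _ _ _ (fun k x => Num.sg (s k x)) _ 1).
- by move=> k; apply: bp_sg => // x; exact: sin_abs_le1.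
- by move=> k x; rewrite normr_sg; case: (_ != _); rewrite ?ler01.
move=> x; apply: cvg_near_cst; set y := x i j - c.
near=> k; rewrite /s -/y.
have k0 : 0 < k.+1%:R^-1 :> R by rewrite invr_gt0.
rewrite [y in sin (_ * y)]numEsg mulrCA sin_sg sgrM sgr_id.
have [->|y0] := eqVneq y 0; first by rewrite sgr0 mul0r.
rewrite [Num.sg (sin _)]gtr0_sg ?mulr1//; apply: sin_gt0_pi.
rewrite mulr_gt0 ?normr_gt0//= mulrC ltr_pdivrMr// -ltr_pdivrMl ?pi_gt0//.
apply: (@le_lt_trans _ _ k%:R); last by rewrite ltr_nat.
by near: k; exact: nbhs_infty_ger.
Unshelve. all: by end_near. Qed.

(** Sets with indicator in the closure form a sigma-algebra, so cylinders suffice; for a fixed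
    coordinate the same argument reduces to open rays. *)
Lemma bp_mxcos_indic (S : set 'M[R]_(m, n)) :
  measurable S -> bp_closure mxcos (\1_S).
Proof.
have [sig0 sigC sigU] := bp_sigma.
apply: (smallest_sub bp_sigma) => _ [i [j [A [mA ->]]]] /=.
pose G := [set B : set R | bp_closure mxcos (\1_[set x : 'M[R]_(m, n) | B (x i j)])].
have sigG : sigma_algebra setT G.
  split => [|B GB|B GB].
  - exact: sig0.
  - exact: (sigC _ GB).
  - exact: (sigU (fun k => [set x | B k (x i j)]) GB).
have : (@RGenOInfty.G R).-sigma.-measurable A.
  by rewrite -RGenOInfty.measurableE.
apply: (smallest_sub sigG) => _ [c ->]; rewrite /G /=.
have bs := bp_mxcos_sg i j c.
(* For a sign [s], the value [(s * s + s) / 2] is 1 if [s = 1] and 0 if [s] is 0 or -1. *)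
apply: bp_eq (bpZ bp_mxcos1 2^-1 (bpD (bpM bs bs) bs)) _ => x.
rewrite indicE; have [xc|xc|xc] := ltrgtP (x i j) c.
- rewrite memNset ?ltr0_sg ?subr_lt0//= ?in_itv/= ?andbT.
    by rewrite mulrNN mulr1 subrr mulr0.
  by rewrite ltNge ltW.
- rewrite mem_set ?gtr0_sg ?subr_gt0//= ?in_itv/= ?andbT//.
  by rewrite mulr1; field.
- rewrite memNset/= ?in_itv/= ?andbT xc ?ltxx//.
  by rewrite subrr sgr0 mulr0 addr0 mulr0.
Qed.

End mxcos.

(* The Cramer-Wold device, as a criterion for independence. *)
Lemma independent_mxcos (R : realType) d (Omega : measurableType d)
    (P : probability Omega R) m n p q
    (X : Omega -> 'M[R]_(m, n)) (Z : Omega -> 'M[R]_(p, q)) :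
  measurable_fun setT X -> measurable_fun setT Z ->
  (forall f g, mxcos f -> mxcos g -> \int[P]_w (f (X w) * g (Z w)) =
     (\int[P]_w f (X w)) * \int[P]_w g (Z w)) ->
  forall A C, measurable A -> measurable C ->
    P (X @^-1` A `&` Z @^-1` C) = (P (X @^-1` A) * P (Z @^-1` C))%E.
Proof.
move=> mX mZ XZ A C mA mC.
have mXA : measurable (X @^-1` A) by rewrite -[_ @^-1` _]setTI; exact: mX.
have mZC : measurable (Z @^-1` C) by rewrite -[_ @^-1` _]setTI; exact: mZ.
have E (S : set Omega) : measurable S -> \int[P]_w \1_S w = fine (P S).
  by move=> mS; rewrite /Rintegral integral_indic// setIT.
have := bp_Rintegral_indep (@mxcos_measurable R m n) (@mxcos_bounded R m n)
  (@mxcos_measurable R p q) (@mxcos_bounded R p q) mX mZ XZ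
  (bp_mxcos_indic mA) (bp_mxcos_indic mC).
have -> : \int[P]_w \1_A (X w) = fine (P (X @^-1` A)) by rewrite -E.
have -> : \int[P]_w \1_C (Z w) = fine (P (Z @^-1` C)) by rewrite -E.
have -> : \int[P]_w (\1_A (X w) * \1_C (Z w)) =
    fine (P (X @^-1` A `&` Z @^-1` C)).
  by rewrite -E ?indicI//; exact: measurableI.
move=> h; rewrite -[LHS]fineK ?fin_num_measure ?h//; last exact: measurableI.
by rewrite EFinM !fineK// fin_num_measure.
Qed.

(** * The algebra of the posterior *)

Lemma sum_mxvec_index (V : nmodType) m n (F : 'I_(m * n) -> V) :
  \sum_p F p = \sum_i \sum_j F (mxvec_index i j).
Proof.
rewrite pair_bigA (reindex (uncurry (@mxvec_index m n)))/=.
  by apply: eq_bigr => -[].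
exact: curry_mxvec_bij.
Qed.

Lemma mxvec_dot (R : comPzRingType) m n (a x : 'M[R]_(m, n)) :
  (mxvec x *m (mxvec a)^T) 0 0 = \tr (a^T *m x).
Proof.
rewrite mxE sum_mxvec_index /mxtrace.
under [RHS]eq_bigr do rewrite mxE.
rewrite exchange_big/=; do 2!apply: eq_bigr => ? _.
by rewrite !mxE !mxvecE mulrC.
Qed.

(** The two summands of [symkron] contribute [a^T] and [a]. Covariances thus become traces of
    [N]-by-[N] matrices, where cyclicity is available. *)
Lemma symkron_form (R : realType) N (A a b : 'M[R]_N) :
  (mxvec a *m symkron A *m (mxvec b)^T) 0 0 =
  2^-1 * \tr ((a + a^T) *m (A *m b *m A^T)).
Proof.
have E (i j : 'I_N) : (A *m b *m A^T) i j = \sum_k \sum_l A i k * b k l * A j l.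
  rewrite !mxE; under eq_bigr do rewrite !mxE mulr_suml.
  by rewrite exchange_big.
rewrite mulmxDl mxtraceD.
have -> : \tr (a *m (A *m b *m A^T)) =
    \sum_i \sum_j \sum_k \sum_l a i j * (A j k * b k l * A i l).
  rewrite /mxtrace; apply: eq_bigr => i _; rewrite mxE; apply: eq_bigr => j _.
  by rewrite E mulr_sumr; apply: eq_bigr => k _; exact: mulr_sumr.
have -> : \tr (a^T *m (A *m b *m A^T)) =
    \sum_i \sum_j \sum_k \sum_l a i j * (A i k * b k l * A j l).
  rewrite /mxtrace exchange_big/=; apply: eq_bigr => i _.
  rewrite mxE; apply: eq_bigr => j _; rewrite [a^T _ _]mxE.
  by rewrite E mulr_sumr; apply: eq_bigr => k _; exact: mulr_sumr.
rewrite -big_split/= mulr_sumr mxE sum_mxvec_index.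
have -> : \sum_k \sum_l (mxvec a *m symkron A) 0 (mxvec_index k l) *
      (mxvec b)^T (mxvec_index k l) 0 =
    \sum_k \sum_l \sum_i \sum_j
      a i j * symkron A (mxvec_index i j) (mxvec_index k l) * b k l.
  apply: eq_bigr => k _; apply: eq_bigr => l _.
  rewrite [_^T _ _]mxE mxvecE mxE sum_mxvec_index mulr_suml.
  apply: eq_bigr => i _; rewrite mulr_suml; apply: eq_bigr => j _.
  by rewrite mxvecE.
under eq_bigr do rewrite exchange_big.
rewrite exchange_big/=; apply: eq_bigr => i _.
under eq_bigr do rewrite exchange_big.
rewrite exchange_big/= -big_split/= mulr_sumr; apply: eq_bigr => j _.
rewrite -big_split/= mulr_sumr; apply: eq_bigr => k _.
rewrite -big_split/= mulr_sumr; apply: eq_bigr => l _.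
by rewrite symkronE; ring.
Qed.

Lemma symkron_tr (R : realType) N (A : 'M[R]_N) :
  A^T = A -> (symkron A)^T = symkron A.
Proof.
move=> AT; have AE i j : A i j = A j i by rewrite -[in LHS]AT mxE.
apply/matrixP => p q; rewrite mxE.
case/mxvec_indexP: p => i j; case/mxvec_indexP: q => k l; rewrite !symkronE.
by rewrite (AE k i) (AE l j) (AE l i) (AE k j) [A j k * _]mulrC.
Qed.

Lemma congr_addmx_tr (R : comPzRingType) N (Q a : 'M[R]_N) :
  Q^T *m a *m Q + (Q^T *m a *m Q)^T = Q^T *m (a + a^T) *m Q.
Proof. by rewrite !trmx_mul trmxK mulmxDr mulmxDl !mulmxA. Qed.

Section posterior_algebra.
Context (R : realType) (N M : nat) (W : 'M[R]_N) (S : 'M[R]_(N, M)).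
Hypotheses (W_pd : sympd W) (S_rank : \rank S = M).

Let WT : W^T = W.
Proof. exact: W_pd.1. Qed.
Local Notation G := (invmx (S^T *m W *m S)).

(** A row [x] of the kernel gives [x S^T W S x^T = 0], hence [x S^T = 0] by definiteness and [x = 0]
    by full column rank. *)
Lemma sympd_gram_unit : S^T *m W *m S \in unitmx.
Proof.
rewrite -row_free_unit; apply/inj_row_free => x xSWS.
have xSWS0 : x *m S^T *m W *m S = 0 by rewrite -[RHS]xSWS !mulmxA.
have x1 : x *m S^T = 0.
  apply/eqP; apply: contraT => /(W_pd.2).
  by rewrite trmx_mul trmxK mulmxA xSWS0 mul0mx mxE ltxx.
have : row_free S^T by rewrite /row_free mxrank_tr S_rank.
by move=> /row_free_inj; apply; rewrite x1 mul0mx.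
Qed.

Local Notation K := (S *m G *m S^T).

Let KT : K^T = K.
Proof. by rewrite !trmx_mul trmxK trmx_inv !trmx_mul trmxK WT !mulmxA. Qed.

Let KWK : K *m W *m K = K.
Proof.
have -> : K *m W *m K = S *m (G *m (S^T *m W *m S)) *m G *m S^T.
  by rewrite !mulmxA.
by rewrite mulVmx ?sympd_gram_unit// mulmx1.
Qed.

(** The matrix [Q] of the opening explanation. By [KWK] it is a projection, and it satisfies
    [S^T *m post_res = 0]. *)
Definition post_res : 'M[R]_N := 1%:M - W *m K.

Let resT : post_res^T = 1%:M - K *m W.
Proof. by rewrite linearB/= trmx1 trmx_mul KT WT. Qed.

Lemma post_cov_res : post_cov W S = symkron (post_res *m W *m post_res^T).
Proof.
rewrite /post_cov resT /post_res mulmxBr mulmx1 !mulmxBl mul1mx; congr symkron.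
have -> : W *m K *m W *m (K *m W) = W *m (K *m W *m K) *m W by rewrite !mulmxA.
by rewrite KWK !mulmxA subrr subr0.
Qed.

Lemma post_res_orth : S^T *m W *m post_res^T = 0.
Proof.
rewrite resT mulmxBr mulmx1 !mulmxA.
by rewrite mulmxV ?sympd_gram_unit// mul1mx subrr.
Qed.

(** For [D = B - B0], the difference [D - Q D Q^T] expands into [D K W + W K D - W K D K W], the
    correction terms of the mean; symmetry of [D] turns [(D S)^T] into [S^T D]. *)
Lemma post_mean_res (B B0 : 'M[R]_N) : B^T = B -> B0^T = B0 ->
  post_mean W B0 S (B *m S) + post_res *m (B - B0) *m post_res^T = B.
Proof.
move=> BT B0T; rewrite /post_mean -mulmxBl resT /post_res.
apply: (@etrans _ _ (B - B0 + B0)); last exact: subrK.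
have : (B - B0)^T = B - B0 by rewrite linearB/= BT B0T.
move: (B - B0) => D DT; rewrite trmx_mul DT.
rewrite mulmxBr mulmx1 !mulmxBl mul1mx.
have -> : D *m S *m G *m S^T *m W = D *m (K *m W) by rewrite !mulmxA.
have -> : W *m S *m G *m (S^T *m D) = W *m K *m D by rewrite !mulmxA.
have -> : W *m S *m G *m (S^T *m (D *m S)) *m G *m S^T *m W =
    W *m K *m D *m (K *m W).
  by rewrite !mulmxA.
move: (D *m (K *m W)) (W *m K *m D) (W *m K *m D *m (K *m W)) => X Y Z.
by apply/matrixP => i j; rewrite !mxE; ring.
Qed.

(** The functional [a] of [Q D Q^T] is the functional [Q^T a Q] of [D], so this is the variance of a
    functional of the residual. *)
Lemma symkron_res (a : 'M[R]_N) :
  (mxvec a *m post_cov W S *m (mxvec a)^T) 0 0 =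
  (mxvec (post_res^T *m a *m post_res) *m symkron W *m
   (mxvec (post_res^T *m a *m post_res))^T) 0 0.
Proof.
rewrite post_cov_res !symkron_form !WT congr_addmx_tr.
rewrite !trmx_mul trmxK WT; congr (_ * _).
by rewrite -!mulmxA [RHS]mxtrace_mulC -!mulmxA.
Qed.

(** Here [b *m S^T] represents the functional [b] of [B *m S]. By cyclicity the trace contains the
    factor [S^T W Q^T = 0], so residual and observation are uncorrelated. *)
Lemma symkron_res_orth (a : 'M[R]_N) (b : 'M[R]_(N, M)) :
  (mxvec (post_res^T *m a *m post_res) *m symkron W *m
   (mxvec (b *m S^T))^T) 0 0 = 0.
Proof.
rewrite symkron_form WT congr_addmx_tr.
rewrite -!mulmxA mxtrace_mulC -!mulmxA (mulmxA S^T W) post_res_orth.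
by rewrite !mulmx0 mxtrace0 mulr0.
Qed.

Lemma post_cov_sympsd : sympsd (symkron W) -> sympsd (post_cov W S).
Proof.
move=> [_ W_psd]; split => [|x].
  by rewrite post_cov_res symkron_tr// !trmx_mul trmxK WT mulmxA.
by rewrite -(vec_mxK x) symkron_res.
Qed.

End posterior_algebra.

(** * Gaussian matrices and conditional distributions *)

Section gaussian_matrix.
Context (R : realType) (m n : nat) (d : measure_display)
  (Omega : measurableType d) (P : probability Omega R)
  (B : {RV P >-> 'M[R]_(m, n)}) (B0 : 'M[R]_(m, n)) (Sigma : 'M[R]_(m * n)).
Hypothesis B_gauss : gaussian (mxvec B0) Sigma (distribution P (mxvec \o B)).

Local Notation cov a b := ((mxvec a *m Sigma *m (mxvec b)^T) 0 0).

Lemma gaussian_mx_law (a : 'M[R]_(m, n)) (A : set R) : measurable A ->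
  P ((fun w => \tr (a^T *m B w)) @^-1` A) = gauss1 (\tr (a^T *m B0)) (cov a a) A.
Proof.
move=> mA; rewrite -mxvec_dot -(B_gauss.2 (mxvec a) A mA).
rewrite /distribution /pushforward; congr (P _).
by apply/seteqP; split => w /=; rewrite mxvec_dot.
Qed.

Lemma gaussian_cov_ge0 (a : 'M[R]_(m, n)) : 0 <= cov a a.
Proof. exact: B_gauss.1.2. Qed.

Lemma gaussian_covC (a b : 'M[R]_(m, n)) : cov a b = cov b a.
Proof.
have -> : cov a b = ((mxvec a *m Sigma *m (mxvec b)^T)^T) 0 0 by rewrite [RHS]mxE.
by rewrite !trmx_mul trmxK B_gauss.1.1 mulmxA.
Qed.

Lemma measurable_gaussian_mx (a : 'M[R]_(m, n)) :
  measurable_fun setT (fun w => \tr (a^T *m B w)).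
Proof.
apply: (measurableT_comp (measurable_mxtrace_mul a)); exact: measurable_funPT.
Qed.

Lemma Rintegral_gaussian_cos (a : 'M[R]_(m, n)) (c : R) :
  \int[P]_w cos (\tr (a^T *m B w) + c) =
  cos (\tr (a^T *m B0) + c) * gauss_cos (cov a a).
Proof.
apply: Rintegral_gauss1_cos.
- exact: measurable_gaussian_mx.
- exact: gaussian_cov_ge0.
- exact: gaussian_mx_law.
Qed.

Lemma gaussian_covD (a b : 'M[R]_(m, n)) : cov a b = 0 ->
  cov (a + b) (a + b) = cov a a + cov b b.
Proof.
move=> ab0; have ba0 : cov b a = 0 by rewrite gaussian_covC.
have D (u v : 'M[R]_1) : (u + v) 0 0 = u 0 0 + v 0 0 by rewrite mxE.
by rewrite !linearD/= !mulmxDl !D ab0 ba0 add0r addr0.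
Qed.

Lemma gaussian_covN (a : 'M[R]_(m, n)) : cov (- a) (- a) = cov a a.
Proof. by rewrite linearN/= [(- mxvec a)^T]linearN/= mulmxN !mulNmx opprK. Qed.

(* The product-to-sum formula reduces the joint expectation to characteristic functions
   of one-dimensional Gaussians. *)
Lemma Rintegral_gaussian_cos_mul (a b : 'M[R]_(m, n)) (c e : R) : cov a b = 0 ->
  \int[P]_w (cos (\tr (a^T *m B w) + c) * cos (\tr (b^T *m B w) + e)) =
  (\int[P]_w cos (\tr (a^T *m B w) + c)) * \int[P]_w cos (\tr (b^T *m B w) + e).
Proof.
move=> ab0.
have covN0 : cov a (- b) = 0.
  by rewrite linearN/= [(- mxvec b)^T]linearN/= mulmxN mxE ab0 oppr0.
have icos u v : P.-integrable setT (fun w => (cos (\tr (u^T *m B w) + v))%:E).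
  apply: (@integrable_bounded _ _ _ _ (fun w => cos (\tr (u^T *m B w) + v)) 1).
    apply: (measurableT_comp (@measurable_cos R)); apply: measurable_funD => //.
    exact: measurable_gaussian_mx.
  by move=> w; exact: cos_abs_le1.
transitivity (\int[P]_w (2^-1 * cos (\tr ((a + b)^T *m B w) + (c + e)) +
    2^-1 * cos (\tr ((a + - b)^T *m B w) + (c - e)))).
  apply: eq_Rintegral => w _.
  rewrite !mxtrace_tr_mulDl !mxtrace_tr_mulNl.
  move: (\tr (a^T *m B w)) (\tr (b^T *m B w)) => u v.
  have -> : u + v + (c + e) = (u + c) + (v + e) by ring.
  have -> : u - v + (c - e) = (u + c) - (v + e) by ring.
  by move: (u + c) (v + e) => p q; rewrite cosD cosB; field.
rewrite (RintegralD measurableT (integrable_scale _ (icos _ _))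
  (integrable_scale _ (icos _ _))).
rewrite !(RintegralZl _ measurableT (icos _ _)).
(* Since [cov a b = 0], the functionals [a + b] and [a - b] have the same variance, and the same
   product of [gauss_cos] values factors out of both terms. *)
rewrite !Rintegral_gaussian_cos gaussian_covD// gaussian_covD// gaussian_covN.
rewrite gauss_cosD ?gaussian_cov_ge0//.
rewrite !mxtrace_tr_mulDl !mxtrace_tr_mulNl.
move: (\tr (a^T *m B0)) (\tr (b^T *m B0)) => u v.
have -> : u + v + (c + e) = (u + c) + (v + e) by ring.
have -> : u - v + (c - e) = (u + c) - (v + e) by ring.
move: (u + c) (v + e) (gauss_cos (cov a a)) (gauss_cos (cov b b)) => p q g h.
by rewrite cosD cosB; field.
Qed.

End gaussian_matrix.

(** * Conditional laws from independence *)

Section independent_kernel.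
Context (R : realType) d d1 d2 d3 (Omega : measurableType d)
  (U : measurableType d1) (V : measurableType d2) (Y : measurableType d3)
  (P : probability Omega R) (E : {RV P >-> U}) (Z : {RV P >-> V})
  (F : V * U -> Y).
Hypothesis mF : measurable_fun setT F.

Let mFE z : measurable_fun setT (fun w => F (z, E w)).
Proof.
apply: measurableT_comp => //; apply/measurable_fun_pairP.
by split; [exact: measurable_cst|exact: measurable_funPT].
Qed.

(** The candidate for the conditional law given [Z = z]: the observation is frozen at [z] while [E]
    keeps its unconditional law. *)
Definition section_law (z : V) : {measure set Y -> \bar R} :=
  pushforward_measure P (mFE z).

Lemma section_lawE z A : section_law z A = P [set w | A (F (z, E w))].
Proof. by []. Qed.

Let section_law_xsection z A :
  section_law z A = distribution P E (xsection (F @^-1` A) z).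
Proof.
rewrite section_lawE /distribution /pushforward; congr (P _).
by apply/seteqP; split => w /=; rewrite /xsection/= ?inE ?in_setE.
Qed.

Let measurable_section_law A : measurable A ->
  measurable_fun setT (section_law ^~ A).
Proof.
move=> mA; under eq_fun do rewrite section_law_xsection.
apply: (measurable_fun_xsection (distribution P E)).
by rewrite -[_ @^-1` _]setTI; exact: mF.
Qed.

HB.instance Definition _ :=
  isKernel.Build _ _ V Y R section_law measurable_section_law.

Let section_law_setT z : section_law z setT = 1%E.
Proof. exact: probability_setT. Qed.

HB.instance Definition _ :=
  Kernel_isProbability.Build _ _ V Y R section_law section_law_setT.

Hypothesis EZ : forall A C, measurable A -> measurable C ->
  P (E @^-1` A `&` Z @^-1` C) = (P (E @^-1` A) * P (Z @^-1` C))%E.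

(** By independence the joint law of [(Z, E)] is the product law, which measures a set by
    integrating over its sections. *)
Lemma cond_distribution_section_law :
  cond_distribution P (fun w => F (Z w, E w)) Z section_law.
Proof.
move=> A C mA mC.
(* The event that [Z] lies in [C] and [F (Z, E)] in [A], as a set of pairs. *)
pose D : set (V * U) := (C `*` setT) `&` F @^-1` A.
have mFA : measurable (F @^-1` A) by rewrite -[_ @^-1` _]setTI; exact: mF.
have mD : measurable D by apply: measurableI => //; exact: measurableX.
have mZE : measurable_fun setT (fun w => (Z w, E w)).
  by apply/measurable_fun_pairP; split; exact: measurable_funPT.
have prodE : (distribution P Z \x distribution P E)%E D =
    pushforward_measure P mZE D.
  apply: product_measure_unique => // C' A' mC' mA'.
  by rewrite /= /pushforward muleC -EZ// setIC.
transitivity (pushforward_measure P mZE D).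
  rewrite /= /pushforward; congr (P _).
  by apply/seteqP; split => w /=; [move=> [h1 h2]; split|move=> [[h1 _] h2]].
rewrite -prodE /product_measure1.
rewrite ge0_integral_distribution//; last exact: measurable_fun_xsection.
rewrite [RHS]integral_mkcond; apply: eq_integral => w _ /=.
rewrite patchE section_law_xsection /distribution /pushforward.
(* Over [C] the section of [D] is that of the preimage of [A]; elsewhere it is empty, matching the
   restricted integrand. *)
case: ifPn; rewrite ?in_setE ?notin_setE/= => ZwC.
  congr (P _); apply/seteqP; split => v /=; rewrite /xsection/= !in_setE.
    by move=> [].
  by move=> h; split.
apply: etrans (measure0 P); congr (P _); apply/seteqP; split => v //=.
by rewrite /xsection/= in_setE => -[[]].
Qed.

End independent_kernel.

(** * Almost sure uniqueness of conditional laws *)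

Section cond_distribution_unique.
Context (R : realType) d d1 d2 (Omega : measurableType d)
  (V : measurableType d1) (Y : measurableType d2)
  (P : probability Omega R) (X : Omega -> Y) (Z : {RV P >-> V})
  (k1 k2 : R.-pker V ~> Y).
Hypotheses (k1P : cond_distribution P X Z k1) (k2P : cond_distribution P X Z k2).

(** Both kernels have the same integrals over every measurable [C] against the law of [Z], so they
    agree off a null set of that law, which is pulled back to [Omega]. *)
Lemma cond_distribution_ae_eq (A : set Y) : measurable A ->
  \forall w \ae P, k1 (Z w) A = k2 (Z w) A.
Proof.
move=> mA.
have mk (k : R.-pker V ~> Y) : measurable_fun setT (k ^~ A).
  exact: measurable_kernel.
have k_le1 (k : R.-pker V ~> Y) z : (k z A <= 1)%E.
  by rewrite -(prob_kernel (s := k) z) le_measure ?inE.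
have ki (k : R.-pker V ~> Y) : (distribution P Z).-integrable setT (k ^~ A).
  apply: (@le_integrable _ _ _ _ _ _ _ (cst 1%E)) => //.
    by move=> z _; rewrite gee0_abs//= normr1.
  exact: finite_measure_integrable_cst.
have kE (k : R.-pker V ~> Y) C : measurable C ->
    (\int[distribution P Z]_(z in C) k z A = \int[P]_(w in Z @^-1` C) k (Z w) A)%E.
  by move=> mC; rewrite ge0_integral_pushforward//; exact: measurable_funTS.
have [] := @integral_ae_eq _ _ _ (distribution P Z) setT measurableT _ _
    (ki k1) (mk k2).
  by move=> C _ mC; rewrite !kE// -k1P// -k2P.
move=> N [mN N0 subN]; exists (Z @^-1` N); split => //.
- by rewrite -[_ @^-1` _]setTI; exact: measurable_funPT.
- by move=> w /= nw; apply: subN => /= h; apply: nw; exact: h.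
Qed.

(** For a single [A] the exceptional null set depends on [A]. Countably many null sets can be
    united, and a generating family stable under intersections determines a probability measure. *)
Lemma cond_distribution_unique (h : (set Y)^nat) :
  @measurable _ Y = <<s range h >> -> setI_closed (range h) ->
  \bigcup_n h n = setT ->
  \forall w \ae P, forall A, measurable A -> k1 (Z w) A = k2 (Z w) A.
Proof.
move=> hE hI hT.
have mh n : measurable (h n) by rewrite hE; apply: sub_sigma_algebra; exists n.
have : \forall w \ae P, forall n, k1 (Z w) (h n) = k2 (Z w) (h n).
  by apply: ae_foralln => n; exact: cond_distribution_ae_eq.
apply: filterS => w kw A mA; apply: (measure_unique (range h) h) => //.
- by move=> _ [n _ <-].
- move=> n; apply: (@le_lt_trans _ _ 1%E); last exact: ltry.
  by rewrite -(prob_kernel (s := k1) (Z w)) le_measure ?inE.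
Qed.

End cond_distribution_unique.

(** * Rational boxes generate the matrix sigma-algebra *)

Section rational_boxes.
Context (R : realType) (m n : nat).
Local Notation mx := 'M[R]_(m, n).

(* A number encoding no matrix stands for [q = 0]. *)
Definition rat_box (k : nat) : set mx :=
  let q : 'M[rat]_(m, n) := odflt 0 (unpickle k) in
  [set x | forall i j, ratr (q i j) < x i j].

Lemma rat_boxE (q : 'M[rat]_(m, n)) :
  rat_box (pickle q) = [set x : mx | forall i j, ratr (q i j) < x i j].
Proof. by rewrite /rat_box pickleK. Qed.

(** Density of the rationals, entry by entry. The free lower bounds [c] serve both the covering and
    the approximation of half-spaces. *)
Lemma rat_boxP (x : mx) (c : 'I_m -> 'I_n -> R) :
  (forall i j, c i j < x i j) ->
  exists2 q : 'M[rat]_(m, n),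
    (forall i j, c i j < ratr (q i j)) & rat_box (pickle q) x.
Proof.
move=> cx; pose q i j := sval (cid (rat_in_itvoo (cx i j))).
have qP i j : c i j < ratr (q i j) < x i j.
  by have := svalP (cid (rat_in_itvoo (cx i j))); rewrite in_itv.
exists (\matrix_(i, j) q i j) => [i j|]; first by rewrite mxE; case/andP: (qP i j).
by rewrite rat_boxE => i j; rewrite mxE; case/andP: (qP i j).
Qed.

Lemma rat_box_setI_closed : setI_closed (range rat_box).
Proof.
move=> _ _ [k _ <-] [l _ <-].
pose p : 'M[rat]_(m, n) := odflt 0 (unpickle k).
pose q : 'M[rat]_(m, n) := odflt 0 (unpickle l).
(* Two boxes intersect in the box whose corner is the entrywise maximum. *)
exists (pickle (\matrix_(i, j) Num.max (p i j) (q i j))) => //.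
rewrite rat_boxE; apply/seteqP; split => [x h|x [hp hq] i j].
  by split => i j; apply: le_lt_trans (h i j); rewrite mxE ler_rat le_max lexx ?orbT.
by rewrite mxE; case: (leP (p i j) (q i j)).
Qed.

Lemma rat_box_cover : \bigcup_k rat_box k = setT.
Proof.
apply/seteqP; split => // x _.
have [|q _ qx] := @rat_boxP x (fun i j => x i j - 1); last by exists (pickle q).
by move=> i j; rewrite ltrBlDr ltrDl.
Qed.

Lemma measurable_rat_box k : measurable (rat_box k).
Proof.
pose q : 'M[rat]_(m, n) := odflt 0 (unpickle k).
have -> : rat_box k =
    \bigcap_(i in [set: 'I_m]) \bigcap_(j in [set: 'I_n])
      ((fun x : mx => x i j) @^-1` `]ratr (q i j), +oo[).
  apply/seteqP; split => x /= h i; last first.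
    by move=> j; have := h i I j I; rewrite /= in_itv/= andbT.
  by move=> _ j _ /=; rewrite in_itv/= andbT.
apply: fin_bigcap_measurable => // i _; apply: fin_bigcap_measurable => // j _.
by rewrite -[_ @^-1` _]setTI; exact: measurable_coord.
Qed.

(** Cylinders over rays []c, +oo[] suffice, and each is the union of the countably many boxes whose
    corner exceeds [c] at the entry [(i, j)]. *)
Lemma measurable_mx_rat_box : @measurable _ mx = <<s range rat_box >>.
Proof.
apply/seteqP; split; last first.
  apply: smallest_sub => [|_ [k _ <-]]; last exact: measurable_rat_box.
  exact: sigma_algebra_measurable.
have sigma_box : sigma_algebra setT <<s range rat_box >>.
  exact: smallest_sigma_algebra.
have [sig0 sigC sigU] := sigma_box.
apply: (smallest_sub sigma_box) => _ [i [j [A [mA ->]]]].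
pose G := [set C : set R | <<s range rat_box >> [set x : mx | C (x i j)]].
have sigG : sigma_algebra setT G.
  split => [|C GC|C GC].
  - exact: sig0.
  - exact: (sigC _ GC).
  - exact: (sigU (fun k => [set x | C k (x i j)]) GC).
have : (@RGenOInfty.G R).-sigma.-measurable A.
  by rewrite -RGenOInfty.measurableE.
apply: (smallest_sub sigG) => _ [c ->]; rewrite /G /=.
pose B k : set mx := if c < ratr ((odflt 0 (unpickle k) : 'M[rat]_(m, n)) i j)
  then rat_box k else set0.
have -> : [set x : mx | x i j \in `]c, +oo[] = \bigcup_k B k.
  apply/seteqP; split => x /=.
    rewrite in_itv/= andbT => cx.
    (* Away from [(i, j)] any bound below the entry of [x] would do; [x i' j' - 1] is one. *)
    have [|q qc qx] := @rat_boxP x (fun i' j' =>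
        if (i' == i) && (j' == j) then c else x i' j' - 1).
      move=> i' j'; case: ifPn => [/andP[/eqP-> /eqP->]//|_].
      by rewrite ltrBlDr ltrDl.
    exists (pickle q) => //; rewrite /B pickleK /=.
    by have := qc i j; rewrite !eqxx/= => ->.
  move=> [k _]; rewrite /B; case: ifP => // ck xk.
  by rewrite in_itv/= andbT (lt_trans ck).
apply: sigU => k; rewrite /B; case: ifP => _; last exact: sig0.
by apply: sub_sigma_algebra; exists k.
Qed.

End rational_boxes.

(** * Measurability of matrix operations *)

Section measurable_mx_ops.
Context (R : realType) d (T : measurableType d).

Lemma measurable_mx_coord m n (f : T -> 'M[R]_(m, n)) i j :
  measurable_fun setT f -> measurable_fun setT (fun t => f t i j).
Proof.
by move=> mf; exact: (measurableT_comp (@measurable_coord _ R m n i j) mf).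
Qed.

Lemma measurable_mxD m n (f g : T -> 'M[R]_(m, n)) :
  measurable_fun setT f -> measurable_fun setT g ->
  measurable_fun setT (fun t => f t + g t).
Proof.
move=> mf mg; apply: measurable_fun_mx => i j; under eq_fun do rewrite mxE.
by apply: measurable_funD; exact: measurable_mx_coord.
Qed.

Lemma measurable_mxN m n (f : T -> 'M[R]_(m, n)) :
  measurable_fun setT f -> measurable_fun setT (fun t => - f t).
Proof.
move=> mf; apply: measurable_fun_mx => i j; under eq_fun do rewrite mxE.
by apply: measurableT_comp => //; exact: measurable_mx_coord.
Qed.

Lemma measurable_trmx m n (f : T -> 'M[R]_(m, n)) :
  measurable_fun setT f -> measurable_fun setT (fun t => (f t)^T).
Proof.
move=> mf; apply: measurable_fun_mx => i j; under eq_fun do rewrite mxE.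
exact: measurable_mx_coord.
Qed.

Lemma measurable_mulmxl m n p (f : T -> 'M[R]_(m, n)) (C : 'M[R]_(n, p)) :
  measurable_fun setT f -> measurable_fun setT (fun t => f t *m C).
Proof.
move=> mf; apply: measurable_fun_mx => i j; under eq_fun do rewrite mxE.
apply: measurable_sum => k; apply: measurable_funM => //.
exact: measurable_mx_coord.
Qed.

Lemma measurable_mulmxr m n p (f : T -> 'M[R]_(n, p)) (C : 'M[R]_(m, n)) :
  measurable_fun setT f -> measurable_fun setT (fun t => C *m f t).
Proof.
move=> mf; apply: measurable_fun_mx => i j; under eq_fun do rewrite mxE.
apply: measurable_sum => k; apply: measurable_funM => //.
exact: measurable_mx_coord.
Qed.

End measurable_mx_ops.

Lemma measurable_post_mean (R : realType) N M (W B0 : 'M[R]_N)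
    (S : 'M[R]_(N, M)) : measurable_fun setT (post_mean W B0 S).
Proof.
have mD : measurable_fun setT (fun Y : 'M[R]_(N, M) => Y - B0 *m S).
  by apply: measurable_mxD => //; exact: measurable_cst.
rewrite /post_mean; apply: measurable_mxD; last first.
  apply: measurable_mxN; do 3!apply: measurable_mulmxl.
  by do 2!apply: measurable_mulmxr.
apply: measurable_mxD; last by apply: measurable_mulmxr; exact: measurable_trmx.
apply: measurable_mxD; first exact: measurable_cst.
by do 3!apply: measurable_mulmxl.
Qed.

(** * The posterior law *)

Theorem theorem2p3 (R : realType) (N M : nat) (W B0 : 'M[R]_N)
    (S : 'M[R]_(N, M)) (d : measure_display) (Omega : measurableType d)
    (P : probability Omega R) (B : {RV P >-> 'M[R]_N})
    (M_ge1 : (1 <= M)%N) (M_leN : (M <= N)%N)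
    (W_pd : sympd W) (B0_sym : B0^T = B0)
    (B_sym : forall w, (B w)^T = B w)
    (B_prior : gaussian (mxvec B0) (symkron W) (distribution P (mxvec \o B)))
    (S_rank : \rank S = M) :
  let vecB : Omega -> 'rV[R]_(N * N) := fun w => mxvec (B w) in
  let BS : Omega -> 'M[R]_(N, M) := fun w => B w *m S in
  (* a version of the posterior is the stated Gaussian at every attained Y *)
  (exists post : R.-pker 'M[R]_(N, M) ~> 'rV[R]_(N * N),
     cond_distribution P vecB BS post /\
     forall Y : 'M[R]_(N, M),
       (exists Bt : 'M[R]_N, Bt^T = Bt /\ Y = Bt *m S) ->
       gaussian (mxvec (post_mean W B0 S Y)) (post_cov W S) (post Y))
  /\
  (* and every version is so almost surely *)
  (forall post : R.-pker 'M[R]_(N, M) ~> 'rV[R]_(N * N),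
     cond_distribution P vecB BS post ->
     {ae P, forall w,
       gaussian (mxvec (post_mean W B0 S (BS w))) (post_cov W S)
         (post (BS w))}).
Proof.
move=> vecB BS; pose Q := post_res W S.
have mB : measurable_fun setT B by exact: measurable_funPT.
have mE : measurable_fun setT (fun w => Q *m (B w - B0) *m Q^T).
  apply: measurable_mulmxl; apply: measurable_mulmxr; exact: measurable_mxD.
have mZ : measurable_fun setT BS by exact: measurable_mulmxl.
pose E : {RV P >-> 'M[R]_N} := HB.pack (fun w => Q *m (B w - B0) *m Q^T)
  (isMeasurableFun.Build _ _ _ _ _ mE).
pose Z : {RV P >-> 'M[R]_(N, M)} := HB.pack BS (isMeasurableFun.Build _ _ _ _ _ mZ).
pose F (ze : 'M[R]_(N, M) * 'M[R]_N) : 'rV[R]_(N * N) :=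
  mxvec (post_mean W B0 S ze.1 + ze.2).
have mF : measurable_fun setT F.
  apply: (measurableT_comp (@measurable_mxvec R N N)); apply: measurable_mxD.
    by apply: (measurableT_comp (@measurable_post_mean R N M W B0 S)).
  by [].
(* A functional of the residual is a functional of [B] up to a constant, which a cosine absorbs into
   its phase. *)
have EE (a : 'M[R]_N) w : \tr (a^T *m E w) =
    \tr ((Q^T *m a *m Q)^T *m B w) - \tr ((Q^T *m a *m Q)^T *m B0).
  have -> : \tr (a^T *m E w) = \tr ((Q^T *m a *m Q)^T *m (B w - B0)).
    by rewrite !trmx_mul trmxK /= !mulmxA mxtrace_mulC !mulmxA.
  by rewrite mulmxBr linearB.
have ZE (b : 'M[R]_(N, M)) w : \tr (b^T *m Z w) = \tr ((b *m S^T)^T *m B w).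
  by rewrite trmx_mul trmxK /= mulmxA mxtrace_mulC mulmxA.
have EZ : forall A C, measurable A -> measurable C ->
    P (E @^-1` A `&` Z @^-1` C) = (P (E @^-1` A) * P (Z @^-1` C))%E.
  apply: independent_mxcos => // _ _ [a [c ->]] [b [e ->]].
  under eq_Rintegral do rewrite EE ZE -addrA.
  under [in RHS]eq_Rintegral do rewrite EE -addrA.
  under [X in _ * X]eq_Rintegral do rewrite ZE.
  apply: (Rintegral_gaussian_cos_mul B_prior).
  exact: symkron_res_orth.
(* Each realisation of [B] is recovered from observation and residual, so the kernel built from [F]
   is a conditional law of [vecB] itself. *)
have vecBE : vecB = fun w => F (Z w, E w).
  by apply/funext => w; rewrite /F/= post_mean_res.
have condP : cond_distribution P vecB BS (section_law E mF).
  by rewrite vecBE; exact: (cond_distribution_section_law mF EZ).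
have gauss Y : gaussian (mxvec (post_mean W B0 S Y)) (post_cov W S)
    (section_law E mF Y).
  split; first exact: post_cov_sympsd B_prior.1.
  move=> a A mA; rewrite section_lawE -(vec_mxK a); move: (vec_mx a) => {}a.
  rewrite (mxvec_dot a) symkron_res//.
  set a' := (post_res W S)^T *m a *m post_res W S.
  set v := (mxvec a' *m _ *m _) 0 0.
  (* The shift [t - t0] turns the functional [a'] of [B] into the functional [a] of posterior mean
     plus residual. *)
  pose t := \tr (a^T *m post_mean W B0 S Y); pose t0 := \tr (a'^T *m B0).
  have mA' : measurable [set u : R | A (u + (t - t0))].
    have mD : measurable_fun [set: R] (fun u : R => u + (t - t0)).
      exact: measurable_funD.
    by rewrite -[X in measurable X]setTI; exact: mD.
  have -> : \tr (a^T *m post_mean W B0 S Y) = t0 + (t - t0) by rewrite /t; ring.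
  rewrite gauss1_shift//; last exact: gaussian_cov_ge0 B_prior _.
  rewrite -(gaussian_mx_law B_prior _ mA'); congr (P _).
  have FE w : \tr (a^T *m (post_mean W B0 S Y + E w)) = \tr (a'^T *m B w) + (t - t0).
    by rewrite mulmxDr mxtraceD EE addrCA.
  by apply/seteqP; split => w; rewrite /F /= mxvec_dot FE.
split.
  exists (section_law E mF); split; first exact: condP.
  by move=> Y _; exact: gauss.
move=> post postP.
(* Any other version almost surely agrees with [section_law] on all measurable sets and inherits its
   Gaussian law; row vectors are matrices with one row. *)
have := cond_distribution_unique (Z := Z) condP postP
  (measurable_mx_rat_box R 1 (N * N)) (@rat_box_setI_closed R 1 (N * N))
  (@rat_box_cover R 1 (N * N)).
apply: filterS => w kE; split; first exact: (gauss (BS w)).1.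
move=> a A mA; rewrite -kE; first exact: (gauss (BS w)).2.
have ma := measurable_mx_coord 0 0
  (measurable_mulmxl a^T (@measurable_id _ 'rV[R]_(N * N) setT)).
by rewrite -[X in measurable X]setTI; exact: ma.
Qed.
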